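(* Let $\mathcal{M}$ be a measure space which is a finite disjoint union $\mathcal{M}=\mathcal{X}_1\cup\cdots\cup\mathcal{X}_N$ of measurable sets with $|\mathcal{X}_j|=\omega_j>0$. Let $1\leqslant p,q\leqslant+\infty$ with $1/p+1/q=1$, and let $\Phi$ be a measurable kernel on $\mathcal{M}\times\mathcal{M}$ with $\{\int_{\mathcal{M}}|\Phi(x,y)|^q\,dy\}^{1/q}<+\infty$ for every $x$ and $\{\int_{\mathcal{M}}(\int_{\mathcal{M}}|\Phi(x,y)|\,dx)^q\,dy\}^{1/q}<+\infty$. Define \[ \Gamma(\Phi)=\sum_{j=1}^N\Big\{\int_{\mathcal{X}_j}\int_{\mathcal{M}}\Big|\int_{\mathcal{X}_j}\big(\Phi(x_j,y)-\Phi(z_j,y)\big)dz_j\Big|^q\,dy\,\frac{dx_j}{\omega_j}\Big\}^{1/q}, \] \[ \Delta(\Phi)=\Big\{\int_{\mathbf{X}}\int_{\mathcal{M}}\Big(\sum_{j=1}^N\Big|\int_{\mathcal{X}_j}\big(\Phi(x_j,y)-\Phi(z_j,y)\big)dz_j\Big|^2\Big)^{q/2}dy\,d\mathbf{x}\Big\}^{1/q}. \] Then for every $1\leqslant p\leqslant+\infty$, \[ \Big\{\int_{\mathbf{X}}\|\mathcal{E}_{\mathbf{x},\boldsymbol\omega}\|_{\Phi,p}^q\,d\mathbf{x}\Big\}^{1/q}\leqslant\Gamma(\Phi), \] and for every $1<p\leqslant+\infty$, \[ A(q)\,\Delta(\Phi)\leqslant\Big\{\int_{\mathbf{X}}\|\mathcal{E}_{\mathbf{x},\boldsymbol\omega}\|_{\Phi,p}^q\,d\mathbf{x}\Big\}^{1/q}\leqslant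 B(q)\,\Delta(\Phi). \] In particular, there exist choices of nodes $x_j\in\mathcal{X}_j$ such that for every $f\in\mathbb{H}^\Phi_p(\mathcal{M})$, $|\sum_{j=1}^N\omega_jf(x_j)-\int_{\mathcal{M}}f(x)dx|\leqslant\Gamma(\Phi)\|f\|_{\mathbb{H}^\Phi_p(\mathcal{M})}$ (for every $1\leqslant p\leqslant+\infty$), respectively $\leqslant B(q)\Delta(\Phi)\|f\|_{\mathbb{H}^\Phi_p(\mathcal{M})}$ (for every $1<p\leqslant+\infty$).
   Context: $\mathbf{X}=\mathcal{X}_1\times\cdots\times\mathcal{X}_N$, $\mathbf{x}=(x_1,\dots,x_N)$, with probability measure $d\mathbf{x}=\frac{dx_1}{\omega_1}\times\cdots\times\frac{dx_N}{\omega_N}$. $\mathbb{H}^\Phi_p(\mathcal{M})$ is the space of all potentials $f(x)=\int_{\mathcal{M}}\Phi(x,y)g(y)\,dy$, $g\in L^p(\mathcal{M})$, with norm $\inf\|g\|_{L^p}$ over all representing $g$. $\mathcal{E}_{\mathbf{x},\boldsymbol\omega}(f)=\sum_{j}\omega_jf(x_j)-\int_{\mathcal{M}}f$, and $\|\mathcal{E}_{\mathbf{x},\boldsymbol\omega}\|_{\Phi,p}=\sup_f|\mathcal{E}_{\mathbf{x},\boldsymbol\omega}(f)|/\|f\|_{\mathbb{H}^\Phi_p(\mathcal{M})}$. $A(q),B(q)$ are the best constants in the Marcinkiewicz--Zygmund inequality: for independent random variables $f_j$, $A(q)\{\mathbb{E}(\sum_j|f_j-\mathbb{E}f_j|^2)^{q/2}\}^{1/q}\leqslant\{\mathbb{E}|\sum_j(f_j-\mathbb{E}f_j)|^q\}^{1/q}\leqslant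 B(q)\{\mathbb{E}(\sum_j|f_j-\mathbb{E}f_j|^2)^{q/2}\}^{1/q}$ (for $1\leqslant q<+\infty$). *)

(* Defs.v *)
From HB Require Import structures.
From mathcomp Require Import all_boot all_order all_algebra.
From mathcomp Require Import all_classical all_reals all_analysis.
Set Implicit Arguments. Unset Strict Implicit. Unset Printing Implicit Defensive.
Import Order.TTheory GRing.Theory Num.Theory.
Import numFieldNormedType.Exports.
Local Open Scope classical_set_scope.
Local Open Scope ring_scope.

Section defs.
Context {R : realType}.

Definition conj_exp (p q : \bar R) : Prop :=
  (p = 1%E /\ q = +oo%E) \/ (p = +oo%E /\ q = 1%E) \/
  exists r s : R, [/\ p = r%:E, q = s%:E, 1 < r, 1 < s & r^-1 + s^-1 = 1].

(* L^q (quasi)norm of a nonnegative extended-real function F : A -> \bar R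
   with respect to an integration functional I on A (the integral of a
   nonnegative function for some measure on A).  For q finite this is
   (I (F^q))^(1/q); for q = +oo it is the essential supremum
   inf { M | I (indicator of [F > M]) = 0 }. *)
Definition LqI {A : Type} (I : (A -> \bar R) -> \bar R) (q : \bar R)
    (F : A -> \bar R) : \bar R :=
  match q with
  | r%:E => ((I (fun a => (F a `^ r)%E)) `^ r^-1)%E
  | +oo%E => ereal_inf [set M : \bar R |
       I (fun a => (if (M < F a)%E then 1 else 0)%:E) = 0%E]
  | -oo%E => 0%E
  end.

Definition mutually_independent {d} {O : measurableType d}
    (P : probability O R) (n : nat) (f : 'I_n -> O -> R) : Prop :=
  forall B : 'I_n -> set R, (forall j, measurable (B j)) ->
    fine (P (\bigcap_j (f j @^-1` B j))) = \prod_(j < n) fine (P (f j @^-1` B j)).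

Definition MZ_family {d} {O : measurableType d} (P : probability O R) (q : R)
    (n : nat) (f : 'I_n -> O -> R) : Prop :=
  [/\ forall j, measurable_fun setT (f j),
      forall j, (Lnorm P q%:E (fun w => (f j w)%:E) < +oo)%E
    & mutually_independent P f].

Definition MZ_lhs {d} {O : measurableType d} (P : probability O R) (q : R)
    (n : nat) (f : 'I_n -> O -> R) : \bar R :=
  Lnorm P q%:E (fun w => (\sum_(j < n) (f j w - Rintegral P setT (f j)))%:E).

Definition MZ_rhs {d} {O : measurableType d} (P : probability O R) (q : R)
    (n : nat) (f : 'I_n -> O -> R) : \bar R :=
  Lnorm P q%:E (fun w =>
    (Num.sqrt (\sum_(j < n) (f j w - Rintegral P setT (f j)) ^+ 2))%:E).

Definition MZ_lower_ok (q A : R) : Prop :=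
  forall (d : measure_display) (O : measurableType d) (P : probability O R)
    (n : nat) (f : 'I_n -> O -> R), MZ_family P q f ->
    (A%:E * MZ_rhs P q f <= MZ_lhs P q f)%E.

Definition MZ_upper_ok (q B : R) : Prop :=
  forall (d : measure_display) (O : measurableType d) (P : probability O R)
    (n : nat) (f : 'I_n -> O -> R), MZ_family P q f ->
    (MZ_lhs P q f <= B%:E * MZ_rhs P q f)%E.

Definition MZ_A (q : R) : \bar R := ereal_sup [set A%:E | A in MZ_lower_ok q].
Definition MZ_B (q : R) : \bar R := ereal_inf [set B%:E | B in MZ_upper_ok q].

Context {d : measure_display} {T : measurableType d}.
Variable mu : {measure set T -> \bar R}.

Definition inLp (p : \bar R) (g : T -> R) : Prop :=
  measurable_fun setT g /\ (Lnorm mu p (fun y => (g y)%:E) < +oo)%E.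

Definition represents (Phi : T -> T -> R) (f g : T -> R) : Prop :=
  forall x, f x = Rintegral mu setT (fun y => Phi x y * g y).

Definition inH (p : \bar R) (Phi : T -> T -> R) (f : T -> R) : Prop :=
  exists g, inLp p g /\ represents Phi f g.

Definition Hnorm (p : \bar R) (Phi : T -> T -> R) (f : T -> R) : \bar R :=
  ereal_inf [set Lnorm mu p (fun y => (g y)%:E) |
             g in [set g | inLp p g /\ represents Phi f g]].

Variables (N : nat) (X : 'I_N -> set T) (omega : 'I_N -> R).

Definition Err (x : 'I_N -> T) (f : T -> R) : R :=
  \sum_(j < N) omega j * f (x j) - Rintegral mu setT f.

(* operator norm of E_{x,omega} on H^Phi_p (sup of |E f| / ||f|| over f != 0
   in H; the sup of this set of nonnegative numbers is taken together with 0) *)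
Definition Err_norm (p : \bar R) (Phi : T -> T -> R) (x : 'I_N -> T) : \bar R :=
  ereal_sup ([set 0%E] `|`
    [set (`|Err x f| / fine (Hnorm p Phi f))%:E |
       f in [set f | inH p Phi f /\ Hnorm p Phi f != 0%E]]).

Definition upd (x : 'I_N -> T) (j : 'I_N) (y : T) : 'I_N -> T :=
  fun i => if i == j then y else x i.

(* iterated integral of a nonnegative function over X = X_1 x ... x X_N
   w.r.t. the product probability measure dx_1/omega_1 x ... x dx_N/omega_N *)
Fixpoint iint (s : seq 'I_N) (F : ('I_N -> T) -> \bar R) (x : 'I_N -> T)
    : \bar R :=
  match s with
  | [::] => F x
  | j :: s' => (((omega j)^-1)%:E * \int[mu]_(y in X j) iint s' F (upd x j y))%E
  end.

Definition prodint (F : ('I_N -> T) -> \bar R) : \bar R :=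
  iint (enum 'I_N) F (fun _ => point).

Definition inner (Phi : T -> T -> R) (j : 'I_N) (xj y : T) : R :=
  Rintegral mu (X j) (fun z => Phi xj y - Phi z y).

Definition Gamma (q : \bar R) (Phi : T -> T -> R) : \bar R :=
  \sum_(j < N) LqI
     (fun F : T * T -> \bar R =>
        (((omega j)^-1)%:E * \int[mu]_(xj in X j) \int[mu]_y F (xj, y))%E)
     q (fun z => `|inner Phi j z.1 z.2|%:E).

Definition Delta (q : \bar R) (Phi : T -> T -> R) : \bar R :=
  LqI (fun F : ('I_N -> T) * T -> \bar R =>
         prodint (fun x => (\int[mu]_y F (x, y))%E))
      q (fun z => (Num.sqrt (\sum_(j < N) (inner Phi j (z.1 j) z.2) ^+ 2))%:E).

Definition avg_err (p q : \bar R) (Phi : T -> T -> R) : \bar R :=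
  LqI prodint q (Err_norm p Phi).

End defs.

(* Main.v *)
(* If f is the potential of g, Fubini turns the quadrature error into a pairing
   of g with the sum over j of inner_j(x_j, .).  By duality the operator norm of
   the error at the nodes x is at most the L^q norm of this sum, with equality
   when q is finite.  Under the product probability the summands are, for almost
   every y, independent centred functions of x: Minkowski's inequality then gives
   Gamma, and the Marcinkiewicz-Zygmund inequality at fixed y, integrated in y,
   gives Delta.  As the average of the norms is bounded, some nodes achieve the
   bound. *)
Require Import Defs.
From HB Require Import structures.
From mathcomp Require Import all_boot all_order all_algebra.
From mathcomp Require Import all_classical all_reals all_analysis.
From mathcomp Require Import measurable_realfun ess_sup_inf.
From mathcomp Require Import ring lra.
Import Order.TTheory GRing.Theory Num.Theory.
Import numFieldNormedType.Exports.
Local Open Scope classical_set_scope.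
Local Open Scope ring_scope.

Set Implicit Arguments.
Unset Strict Implicit.
Unset Printing Implicit Defensive.

(** * Finite products of probability measures *)

(** Three obstacles shape the proof. The average over the nodes is given as an iterated integral,
    and no measurability of [Err_norm] is at hand when [q = +oo]. So a product probability is built
    that reproduces the iterated integrals of nonnegative measurable functions, and [Err_norm] is
    compared with a measurable norm by monotonicity alone. The Marcinkiewicz-Zygmund constants are
    tested only on families with finite norms, whereas at fixed [y] the kernel is merely integrable.
    If one summand has infinite norm, however, then so do both the sum and the square function, and
    the inequalities persist. Norms and best constants may be [+oo] while [0 * +oo = 0]; hence the
    separate treatment of a vanishing [Delta], and the bound [1 <= B] for every admissible upper
    constant. The condition [1 < p] makes [q] finite: then the norms in [x] and in [y] can be
    exchanged, and an extremal function for the duality exists. *)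

Section coordinates.
Context {d} {T : measurableType d} (N : nat).

Definition coordinate_sets : set (set ('I_N -> T)) :=
  [set A | exists j, exists2 B, measurable B & A = (fun x => x j) @^-1` B].

(** The carrier stays the plain function type, so that the functions of the nodes integrated by
    [prodint] are literally functions on this measurable space. *)
Definition prodT : Type := g_sigma_algebraType coordinate_sets.
HB.instance Definition _ := Measurable.on prodT.

Lemma measurable_coordinate (j : 'I_N) :
  measurable_fun setT (fun x : prodT => x j).
Proof.
by move=> _ B mB; rewrite setTI; apply: sub_sigma_algebra; exists j, B.
Qed.

Lemma measurable_fun_prodT d' (U : measurableType d') (h : U -> prodT) :
  (forall j, measurable_fun setT (fun u => h u j)) -> measurable_fun setT h.
Proof.
move=> mh; apply: (@measurability _ _ U prodT setT h coordinate_sets) => //.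
move=> _ [A [j [B mB ->]] <-].
exact: mh.
Qed.

Lemma measurable_box (A : 'I_N -> set T) : (forall i, measurable (A i)) ->
  measurable [set x : prodT | forall i, A i (x i)].
Proof.
move=> mA; rewrite (_ : [set _ | _] =
    \bigcap_(i in [set` enum 'I_N]) ((fun x : prodT => x i) @^-1` A i)); last first.
  apply/seteqP; split=> [x /= Ax i _|x /= Ax i]; first exact: Ax.
  by apply: Ax; rewrite /= mem_enum.
apply: fin_bigcap_measurable; first exact: finite_seq.
by move=> i _; rewrite -[X in measurable X]setTI; exact: measurable_coordinate.
Qed.

Lemma measurable_upd (j : 'I_N) :
  measurable_fun setT (fun z : T * prodT => (upd z.2 j z.1 : prodT)).
Proof.
apply: measurable_fun_prodT => i; rewrite /upd.
case: (i == j); first exact: measurable_fst.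
apply: (@measurableT_comp _ _ _ _ _ _ (fun x : prodT => x i) _ snd) => //.
exact: measurable_coordinate.
Qed.

Lemma measurable_upd2 (j : 'I_N) (y : T) :
  measurable_fun setT (fun x : prodT => (upd x j y : prodT)).
Proof.
exact: (measurableT_comp (measurable_upd j) (measurable_pair1 y)).
Qed.

Lemma upd_same (x : 'I_N -> T) (j : 'I_N) (y z : T) :
  upd (upd x j y) j z = upd x j z.
Proof. by apply/funext => i; rewrite /upd; case: eqP. Qed.

Lemma upd_swap (x : 'I_N -> T) (i j : 'I_N) (y z : T) : i != j ->
  upd (upd x j y) i z = upd (upd x i z) j y.
Proof.
move=> ij; apply/funext => k; rewrite /upd.
by case: eqP => // ->; rewrite (negbTE ij).
Qed.

(** Form of [upd] that can be bundled as a measurable map, as the pushforward [distribution]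
    requires. *)
Definition upd_fun (j : 'I_N) (z : T * prodT) : prodT := upd z.2 j z.1.

HB.instance Definition _ (j : 'I_N) :=
  isMeasurableFun.Build _ _ _ _ (upd_fun j) (measurable_upd j).

End coordinates.

Lemma integral_prob_cst {R : realType} {d} {T : measurableType d}
  (P : probability T R) (c : \bar R) : (\int[P]_x c = c)%E.
Proof.
transitivity (c * P setT)%E; first exact: (integral_cst P measurableT c).
by rewrite probability_setT mule1.
Qed.

Section finite_product.
Context {R : realType} {d} {T : measurableType d} {N : nat}.
Variable Q : 'I_N -> probability T R.
Local Notation O := (@prodT d T N).

Definition point_at : probability O R := @dirac _ O (fun _ => point) R.

(** Built by overwriting one coordinate at a time with an independent sample, which mirrors the
    recursion of [iint]. Coordinates outside [s] stay at [point]. *)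
Fixpoint prodP (s : seq 'I_N) : probability O R :=
  match s with
  | [::] => point_at
  | j :: s' => distribution (Q j \x prodP s')%E (upd_fun j)
  end.

Local Open Scope ereal_scope.

(** Coordinate [i] is already a sample of [Q i] independent of the others, so drawing it afresh
    changes nothing. This yields the marginals, and later allows all coordinates but one to be
    frozen. *)
Lemma ge0_integral_prodP_cons j s (F : O -> \bar R) :
  measurable_fun setT F -> (forall x, 0 <= F x) ->
  \int[prodP (j :: s)]_x F x = \int[Q j]_y \int[prodP s]_x F (upd x j y).
Proof.
move=> mF F0 /=; rewrite ge0_integral_distribution// fubini_tonelli1//.
  by apply: measurableT_comp => //; exact: measurable_upd.
by move=> z; exact: F0.
Qed.

Lemma ge0_integral_prodP_resample i s (F : O -> \bar R) : i \in s ->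
  measurable_fun setT F -> (forall x, 0 <= F x) ->
  \int[prodP s]_x F x = \int[prodP s]_x \int[Q i]_z F (upd x i z).
Proof.
elim: s F => // j s IH F; rewrite in_cons => ijs mF F0.
have mFi : measurable_fun setT (fun x : O => \int[Q i]_z F (upd x i z)).
  apply: (@measurable_fun_fubini_tonelli_G _ _ _ _ _ (Q i)
    (fun z : T * O => F (upd z.2 i z.1))) => //.
  exact: (measurableT_comp mF (measurable_upd _)).
rewrite !ge0_integral_prodP_cons//; last by move=> x; exact: integral_ge0.
have [ij|ij] := eqVneq i j.
  (* The second sample overrides the first, so the outer integrand is constant and Tonelli's theorem
     remains. *)
  subst j; under [RHS]eq_integral do under eq_integral do under eq_integral do
    rewrite upd_same.
  rewrite integral_prob_cst.
  apply: (@fubini_tonelli _ _ _ _ _ (Q i) (prodP s)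
    (fun z : T * O => F (upd z.2 i z.1))) => //.
  exact: (measurableT_comp mF (measurable_upd _)).
apply: eq_integral => y _; rewrite IH//.
- apply: eq_integral => x _; apply: eq_integral => z _.
  by rewrite upd_swap// eq_sym.
- by move: ijs; rewrite (negbTE ij).
- exact: (measurableT_comp mF (measurable_upd2 _ _)).
Qed.

Lemma prodP_box s (A : 'I_N -> set T) : uniq s ->
  (forall j, measurable (A j)) -> (forall j, j \notin s -> A j = setT) ->
  prodP s [set x | forall j, A j (x j)] = \prod_(j <- s) Q j (A j).
Proof.
elim: s A => [A _ mA As|j s IH A /= /andP[js us] mA As].
  rewrite big_nil (_ : [set _ | _] = setT) ?probability_setT//.
  by apply/seteqP; split=> // x _ j; rewrite As.
(* The value drawn for [j] overwrites that coordinate, so the tail is constrained only at the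
   others. *)
pose A' i := if i == j then setT else A i.
have mA' i : measurable (A' i) by rewrite /A'; case: ifP.
rewrite /distribution/pushforward/= (_ : _ @^-1` _ =
    A j `*` [set x : O | forall i, A' i (x i)]); last first.
  apply/seteqP; split=> [[y x] /= h|[y x] /= [Ay Ax] i].
    split; first by have := h j; rewrite /upd_fun/upd eqxx.
    by move=> i; have := h i; rewrite /upd_fun/upd/A'; case: eqP.
  by have := Ax i; rewrite /upd_fun/upd/A'; case: eqP => // ->.
rewrite product_measure1E//; last exact: measurable_box.
rewrite big_cons; congr (_ * _); transitivity (\prod_(i <- s) Q i (A' i)).
  apply: IH => // i si; rewrite /A'; case: eqP => // /eqP ij; apply: As.
  by rewrite in_cons negb_or ij si.
apply: eq_big_seq => i si.
by rewrite /A'; case: eqP => // ij; move: js; rewrite -ij si.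
Qed.

Definition productP := prodP (enum 'I_N).

Lemma productP_box (A : 'I_N -> set T) : (forall j, measurable (A j)) ->
  productP [set x | forall j, A j (x j)] = \prod_(j < N) Q j (A j).
Proof.
move=> mA; rewrite prodP_box ?enum_uniq// ?big_enum//.
by move=> j; rewrite mem_enum.
Qed.

Lemma productP_marginal i (B : set T) : measurable B ->
  productP ((fun x => x i) @^-1` B) = Q i B.
Proof.
move=> mB; pose A j := if j == i then B else setT.
rewrite (_ : _ @^-1` _ = [set x | forall j, A j (x j)]); last first.
  apply/seteqP; split=> [x /= Bx j|x /= /(_ i)]; rewrite /A ?eqxx//.
  by case: eqP => // ->.
rewrite productP_box; last by move=> j; rewrite /A; case: ifP.
rewrite (bigD1 i)//= big1 ?mule1 /A ?eqxx// => j /negbTE ->.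
by rewrite probability_setT.
Qed.

Lemma productP_indep (g : 'I_N -> T -> R) :
  (forall j, measurable_fun setT (g j)) ->
  mutually_independent productP (fun j x => g j (x j)).
Proof.
move=> mg B mB.
have mgB j : measurable (g j @^-1` B j) by rewrite -[X in measurable X]setTI; exact: mg.
rewrite (_ : \bigcap_j _ = [set x | forall j, (g j @^-1` B j) (x j)]); last first.
  by apply/seteqP; split=> [x /= h j|x /= h j _]; exact: h.
transitivity (fine (\prod_(j < N) Q j (g j @^-1` B j))).
  congr fine; exact: (productP_box (A := fun j => g j @^-1` B j)).
rewrite (eq_bigr (fun j => (fine (Q j (g j @^-1` B j)))%:E)); last first.
  by move=> j _; rewrite fineK// fin_num_measure.
rewrite prodEFin /=; apply: eq_bigr => j _; congr fine.
by apply/esym; exact: (productP_marginal j (mgB j)).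
Qed.

Lemma ge0_integral_productP_marginal i (h : T -> \bar R) :
  measurable_fun setT h -> (forall y, 0 <= h y) ->
  \int[productP]_x h (x i) = \int[Q i]_y h y.
Proof.
move=> mh h0.
rewrite /productP (@ge0_integral_prodP_resample i)//=; last 2 first.
- by rewrite mem_enum.
- exact: (measurableT_comp mh (measurable_coordinate _)).
under eq_integral do under eq_integral do rewrite /upd eqxx.
by rewrite integral_prob_cst.
Qed.

Section iterated_integral.
Variables (mu : {measure set T -> \bar R}) (X : 'I_N -> set T).
Variable omega : 'I_N -> R.
Hypothesis omega0 : forall j, (0 < omega j)%R.
Hypothesis QE : forall j (h : T -> \bar R), measurable_fun setT h ->
  (forall y, 0 <= h y) ->
  \int[Q j]_y h y = ((omega j)^-1)%:E * \int[mu]_(y in X j) h y.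

Lemma iint_ge0 s (F : O -> \bar R) x : (forall x, 0 <= F x) ->
  0 <= iint mu X omega s F x.
Proof.
move=> F0; elim: s x => //= j s IH x; apply: mule_ge0.
  by rewrite lee_fin invr_ge0 ltW.
by apply: integral_ge0.
Qed.

Lemma iint_upd j s (F : O -> \bar R) x y : j \notin s ->
  iint mu X omega s F (upd x j y) =
  iint mu X omega s (fun x => F (upd x j y)) x.
Proof.
elim: s x => //= i s IH x; rewrite in_cons negb_or => /andP[ji js].
by congr (_ * _); apply: eq_integral => z _; rewrite upd_swap ?IH// eq_sym.
Qed.

(** Replaces the iterated integral of the statement by integration against a genuine measure, where
    almost-everywhere arguments and norm inequalities are available. Both sides peel off the head
    coordinate. *)
Lemma ge0_integral_prodPE s (F : O -> \bar R) : uniq s ->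
  measurable_fun setT F -> (forall x, 0 <= F x) ->
  \int[prodP s]_x F x = iint mu X omega s F (fun _ => point).
Proof.
elim: s F => [F _ mF F0|j s IH F /= /andP[js us] mF F0].
  by rewrite /= integral_dirac// diracT mul1e.
have IHj y : \int[prodP s]_x F (upd x j y) =
    iint mu X omega s F (upd (fun _ => point) j y).
  rewrite iint_upd// IH//; exact: (measurableT_comp mF (measurable_upd2 _ _)).
have -> : \int[prodP (j :: s)]_x F x =
    \int[Q j]_y \int[prodP s]_x F (upd x j y) by exact: ge0_integral_prodP_cons.
rewrite QE//.
- by congr (_ * _); apply: eq_integral => y _; rewrite IHj.
- apply: (@measurable_fun_fubini_tonelli_F _ _ _ _ _ (prodP s)
    (fun z : T * O => F (upd z.2 j z.1))) => //.
  exact: (measurableT_comp mF (measurable_upd _)).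
- by move=> y; exact: integral_ge0.
Qed.

End iterated_integral.
End finite_product.

(** * L^q norms *)

Section integral_monotone.
Context {R : realType} {d} {S : measurableType d}.
Variable nu : {measure set S -> \bar R}.
Local Open Scope ereal_scope.

Lemma measurable_abse_poweR (h : S -> \bar R) (r : R) :
  measurable_fun setT h -> measurable_fun setT (fun x => `|h x| `^ r).
Proof.
move=> mh.
exact: (measurableT_comp (measurable_poweR r)
  (measurableT_comp (@abse_measurable R setT) mh)).
Qed.

(* The integral of a nonnegative function is a supremum over simple functions,
   so it is monotone even without measurability. *)
Lemma ge0_le_integral_nomeas (D : set S) (f g : S -> \bar R) :
  (forall x, D x -> 0 <= f x) -> (forall x, D x -> f x <= g x) ->
  \int[nu]_(x in D) f x <= \int[nu]_(x in D) g x.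
Proof.
move=> f0 fg; have g0 x : D x -> 0 <= g x.
  by move=> Dx; rewrite (le_trans (f0 x Dx))// fg.
rewrite !ge0_integralE//; apply: ereal_sup_le => _ [h hf <-] /=; exists h => //=.
move=> x; apply: (le_trans (hf x)); rewrite /patch; case: ifPn => //.
by rewrite inE; exact: fg.
Qed.

End integral_monotone.

Section LqI.
Context {R : realType}.
Local Open Scope ereal_scope.

(** Asks of [I] only monotonicity and positivity on nonnegative functions, so it applies to
    [prodint] and to functions whose measurability is unknown. *)
Lemma le_LqI (A : Type) (I : (A -> \bar R) -> \bar R) (q : \bar R)
    (F G : A -> \bar R) :
  (forall f g, (forall a, 0 <= f a) -> (forall a, f a <= g a) -> I f <= I g) ->
  (forall f, (forall a, 0 <= f a) -> 0 <= I f) ->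
  0 < q -> (forall a, 0 <= F a) -> (forall a, F a <= G a) ->
  LqI I q F <= LqI I q G.
Proof.
move=> Imono I0 q0 F0 FG; have G0 a : 0 <= G a by rewrite (le_trans (F0 a)).
have powI : {homo (fun x => I (fun a => x a `^ fine q)) : f g /
    (forall a, 0 <= f a) /\ (forall a, f a <= g a) >-> f <= g}.
  move=> f g [f0 fg]; apply: Imono => a; first exact: poweR_ge0.
  have g0 : 0 <= g a by rewrite (le_trans (f0 a)).
  by apply: gt0_ler_poweR; rewrite ?in_itv/= ?leey ?f0 ?g0 ?fine_ge0 ?(ltW q0).
case: q q0 powI => // [r|]; first rewrite lte_fin => r0 powI; last move=> _ _.
  apply: gt0_ler_poweR; rewrite ?invr_ge0 ?(ltW r0)// ?in_itv/= ?leey ?andbT.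
  - by apply: I0 => a; exact: poweR_ge0.
  - by apply: I0 => a; exact: poweR_ge0.
  - exact: powI.
(* Every essential bound of [G] is one of [F]: the indicator for [F] lies below that for [G]. *)
apply: ereal_inf_le_tmp => M /= MG; apply/eqP; rewrite eq_le; apply/andP; split.
  rewrite -MG; apply: Imono => a; first by case: ifP.
  case: ifPn => MF; last by case: ifP.
  by rewrite (lt_le_trans MF).
by apply: I0 => a; case: ifP.
Qed.

Context {d} {S : measurableType d}.
Variable nu : {measure set S -> \bar R}.

(** At [q = +oo], the integral of the indicator of a superlevel set is its measure, so both sides
    are infima over the same bounds. Positive total mass selects the essential supremum in the
    definition of [Lnorm]. *)
Lemma LqI_Lnorm (I : (S -> \bar R) -> \bar R) (q : \bar R) (G : S -> \bar R) :
  (forall F, measurable_fun setT F -> (forall x, 0 <= F x) ->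
    I F = \int[nu]_x F x) ->
  1 <= q -> 0 < nu setT -> measurable_fun setT G -> (forall x, 0 <= G x) ->
  LqI I q G = 'N[nu]_q[G].
Proof.
move=> IE q1 nu0 mG G0.
have absG : abse \o G = G by apply/funext => x /=; rewrite gee0_abs.
rewrite unlock; case: q q1 => // [r|] q1 /=.
  rewrite IE//; last by move=> x; exact: poweR_ge0.
    by under [in RHS]eq_integral do rewrite gee0_abs//.
  exact: (measurableT_comp (measurable_poweR r) mG).
rewrite nu0 absG ess_supEmu0//; congr ereal_inf; apply/predeqP => M /=.
have mM : measurable (G @^-1` `]M, +oo[).
  by rewrite -[X in measurable X]setTI; apply: mG => //; exact: emeasurable_itv.
rewrite (_ : (fun a => _) = (fun a => (\1_(G @^-1` `]M, +oo[) a)%:E)); last first.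
  apply/funext => a; rewrite indicE/=; congr (_%:E).
  have -> : (a \in G @^-1` `]M, +oo[) = (M < G a).
    by apply/idP/idP; rewrite inE/= in_itv/= andbT.
  by case: ifP.
by rewrite IE ?integral_indic ?setIT//; exact/measurable_EFinP/measurable_indic.
Qed.

End LqI.

Section Lnorm_facts.
Context {R : realType} {d} {S : measurableType d}.
Variable nu : {measure set S -> \bar R}.
Local Open Scope ereal_scope.

Lemma Lnorm_finE (r : R) (f : S -> \bar R) :
  'N[nu]_r%:E[f] = (\int[nu]_x (`|f x| `^ r)) `^ r^-1.
Proof. by rewrite unlock. Qed.

Lemma Lnorm_infE (f : S -> \bar R) : 0 < nu setT ->
  'N[nu]_+oo[f] = ess_sup nu (abse \o f).
Proof. by move=> nu0; rewrite unlock nu0. Qed.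

Lemma ae_le_Lnorm (q : \bar R) (f g : S -> \bar R) : 1 <= q ->
  measurable_fun setT f -> measurable_fun setT g ->
  {ae nu, forall x, `|f x| <= `|g x|} -> 'N[nu]_q[f] <= 'N[nu]_q[g].
Proof.
move=> q1 mf mg fg; rewrite unlock; case: q q1 => // [r|] q1 /=.
  have r0 : (0 < r)%R by rewrite (lt_le_trans ltr01).
  have ip h : \int[nu]_x (`|h x| `^ r) \in `[0, +oo].
    by rewrite in_itv/= leey andbT integral_ge0// => x _; exact: poweR_ge0.
  apply: gt0_ler_poweR => //; first by rewrite invr_ge0 ltW.
  apply: ae_ge0_le_integral => //; try exact: measurable_abse_poweR.
  - by move=> x _; exact: poweR_ge0.
  - by move=> x _; exact: poweR_ge0.
  apply: filterS fg => x fgx _.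
  by apply: gt0_ler_poweR; rewrite ?in_itv/= ?leey ?abse_ge0// ltW.
by case: ifPn => // _; exact: le_ess_sup.
Qed.

Lemma ae_eq_Lnorm (q : \bar R) (f g : S -> \bar R) : 1 <= q ->
  measurable_fun setT f -> measurable_fun setT g ->
  {ae nu, forall x, f x = g x} -> 'N[nu]_q[f] = 'N[nu]_q[g].
Proof.
move=> q1 mf mg fg; apply/eqP; rewrite eq_le; apply/andP.
by split; apply: ae_le_Lnorm => //; apply: filterS fg => x ->.
Qed.

(** Seen through [LqI], a norm depends on the measure only via integrals of nonnegative functions;
    this treats finite and infinite [q] alike. *)
Lemma Lnorm_transfer {d'} {S' : measurableType d'}
    (nu' : {measure set S' -> \bar R}) (phi : S -> S') (q : \bar R)
    (G : S' -> \bar R) :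
  (forall F, measurable_fun setT F -> (forall x, 0 <= F x) ->
    \int[nu]_x F (phi x) = \int[nu']_x F x) ->
  measurable_fun setT phi -> 1 <= q -> 0 < nu setT -> 0 < nu' setT ->
  measurable_fun setT G -> 'N[nu]_q[G \o phi] = 'N[nu']_q[G].
Proof.
move=> tr mphi q1 nu0 nu'0 mG; rewrite -Lnorm_abse -[RHS]Lnorm_abse.
have mabsG : measurable_fun setT (abse \o G) by exact: measurableT_comp.
rewrite -[RHS](LqI_Lnorm (I := fun F => \int[nu]_x F (phi x)))//.
rewrite -[LHS](LqI_Lnorm (I := fun F : S -> \bar R => \int[nu]_x F x))//.
- exact: (measurableT_comp mabsG mphi).
- by move=> x; exact: abse_ge0.
- by move=> x; exact: abse_ge0.
Qed.

Lemma Lnorm_sum (I : Type) (s : seq I) (F : I -> S -> R) (q : \bar R) :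
  1 <= q -> (forall i, measurable_fun setT (F i)) ->
  'N[nu]_q[(fun x => (\sum_(i <- s) F i x)%:E)] <=
  \sum_(i <- s) 'N[nu]_q[(fun x => (F i x)%:E)].
Proof.
move=> q1 mF; elim: s => [|i s IH].
  rewrite big_nil (_ : (fun x => _) = cst 0) ?Lnorm0//.
    by rewrite gt_eqF// (lt_le_trans _ q1).
  by apply/funext => x; rewrite big_nil.
rewrite big_cons; apply: le_trans (leeD2l _ IH).
rewrite (_ : (fun x => _) =
    EFin \o (F i \+ (fun x => \sum_(k <- s) F k x))%R); last first.
  by apply/funext => x; rewrite big_cons.
exact: eminkowski (mF i) (measurable_sum s mF) q1.
Qed.

End Lnorm_facts.

(** * Norms of sections on a product space *)

Section Lnorm_iterated.
Context {R : realType} {d1 d2} {S : measurableType d1} {T : measurableType d2}.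
Variables (P : probability S R) (mu : {sigma_finite_measure set T -> \bar R}).
Variable W : S * T -> R.
Hypothesis mW : measurable_fun setT W.
Local Open Scope ereal_scope.

Lemma product_prob_setT : (P \x mu) setT = mu setT.
Proof.
rewrite -setXTT product_measure1E//; transitivity (1 * mu setT).
  by congr (_ * _); exact: probability_setT.
by rewrite mul1e.
Qed.

(** For finite [q] this is Tonelli's theorem. For [q = +oo], the essential supremum of a section
    exceeds [c] exactly when the section of the set where [|W| > c] has positive measure, and the
    measure of sections is measurable. *)
Lemma measurable_Lnorm_section (q : \bar R) : 1 <= q ->
  measurable_fun setT (fun x => 'N[mu]_q[(fun y => (W (x, y))%:E)]).
Proof.
rewrite unlock; case: q => // [r|] q1 /=.
  apply: (@measurableT_comp _ _ _ _ _ _ _ _ _ (measurable_poweR r^-1)).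
  apply: (@measurable_fun_fubini_tonelli_F _ _ _ _ _ mu
    (fun z => `|(W z)%:E| `^ r)) => //.
  - by apply: measurable_abse_poweR; exact/measurable_EFinP.
  - by move=> z; exact: poweR_ge0.
set b := (X in (fun _ => if X then _ else _)); case: b; last exact: measurable_cst.
apply: (measurability _ (ErealGenOInfty.measurableE R)) => _ [_ [c ->] <-].
rewrite setTI; pose E := [set z | c%:E < `|(W z)%:E|].
have mE : measurable E.
  rewrite -[E]setTI; apply: emeasurable_fun_o_infty => //.
  by apply: measurableT_comp => //; exact/measurable_EFinP.
rewrite (_ : _ @^-1` _ = (mu \o xsection E) @^-1` `]0, +oo[); last first.
  apply/seteqP; split=> x /=; rewrite !in_itv/= !andbT.
  - rewrite !ltNge; apply: contra => mE0; apply/ess_supP.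
    apply/ae_le_measureP; first by apply: measurableT_comp => //;
      apply/measurable_EFinP; exact: (measurableT_comp mW (measurable_pair1 x)).
    apply/eqP; rewrite eq_le measure_ge0 andbT; apply: le_trans mE0.
    apply: le_measure; rewrite ?inE.
    + rewrite -[X in measurable X]setTI; apply: measurableT_comp => //.
        by apply/measurable_EFinP; exact: (measurableT_comp mW (measurable_pair1 x)).
      exact: emeasurable_itv.
    + exact: measurable_xsection.
    + by move=> y /=; rewrite in_itv/= andbT /xsection/E/= inE.
  - rewrite !ltNge; apply: contra => /ess_supP /ae_le_measureP mE0.
    rewrite -mE0; last by apply: measurableT_comp => //;
      apply/measurable_EFinP; exact: (measurableT_comp mW (measurable_pair1 x)).
    apply: le_measure; rewrite ?inE.
    + exact: measurable_xsection.
    + rewrite -[X in measurable X]setTI; apply: measurableT_comp => //.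
        by apply/measurable_EFinP; exact: (measurableT_comp mW (measurable_pair1 x)).
      exact: emeasurable_itv.
    + by move=> y; rewrite /xsection/E/= in_itv/= andbT inE.
rewrite -[X in measurable X]setTI; apply: measurable_fun_xsection => //.
exact: emeasurable_itv.
Qed.

Lemma Lnorm_iterated_fin (r : R) : (1 <= r)%R ->
  'N[P]_r%:E[(fun x => 'N[mu]_r%:E[(fun y => (W (x, y))%:E)])] =
  'N[(P \x mu)]_r%:E[EFin \o W].
Proof.
move=> r1; have r0 : r != 0%R by rewrite gt_eqF// (lt_le_trans ltr01).
rewrite !Lnorm_finE; congr (_ `^ _).
rewrite fubini_tonelli1; last 2 first.
- by apply: measurable_abse_poweR; exact/measurable_EFinP.
- by move=> z; exact: poweR_ge0.
apply: eq_integral => x _; rewrite gee0_abs ?Lnorm_ge0// Lnorm_finE.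
by rewrite -poweRrM mulVf// poweRe1// integral_ge0// => y _; exact: poweR_ge0.
Qed.

(** An equality for finite [q]. At [q = +oo], the set where [|W|] exceeds its essential supremum is
    null in the product, so almost all its sections are null. *)
Lemma Lnorm_iterated_le (q : \bar R) : 1 <= q -> 0 < mu setT ->
  'N[P]_q[(fun x => 'N[mu]_q[(fun y => (W (x, y))%:E)])] <=
  'N[(P \x mu)]_q[EFin \o W].
Proof.
case: q => // [r|] q1 mu0; first by rewrite Lnorm_iterated_fin.
have muP : 0 < (P \x mu) setT by rewrite product_prob_setT.
have PT : 0 < (P : {measure set S -> \bar R}) setT.
  by rewrite [ltRHS]probability_setT.
rewrite [leRHS]Lnorm_infE//.
set M := ess_sup _ _.
rewrite [leLHS]Lnorm_infE//; apply/ess_supP.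
have mabsW : measurable_fun setT (abse \o (EFin \o W)).
  by apply: measurableT_comp => //; exact/measurable_EFinP.
pose E := [set z | M < `|(W z)%:E|].
have mE : measurable E.
  by rewrite -[E]setTI; exact: emeasurable_fun_o_infty.
have E0 : (P \x mu) E = 0.
  have [+ _] := @ae_le_measureP _ _ _ (P \x mu) _ M mabsW.
  move=> /(_ (ess_sup_ge _ _)) <-; congr (_ _).
  by apply/seteqP; split=> z /=; rewrite in_itv/= andbT.
have /(ae_eq_integral_abs P measurableT) : \int[P]_x `|(mu \o xsection E) x| = 0.
  by rewrite -[RHS]E0; apply: eq_integral => x _; rewrite gee0_abs.
move=> /(_ (measurable_fun_xsection mu mE)); apply: filterS => x /= /(_ Logic.I) Ex.
rewrite gee0_abs ?Lnorm_ge0// Lnorm_infE//.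
apply/ess_supP/ae_le_measureP.
  apply: measurableT_comp => //; apply/measurable_EFinP.
  exact: (measurableT_comp mW (measurable_pair1 x)).
rewrite -[RHS]Ex; congr (_ _); apply/seteqP; split => y /=.
  by rewrite in_itv/= andbT /xsection/E/= inE.
by rewrite in_itv/= andbT /xsection/E/= inE.
Qed.

End Lnorm_iterated.

(** * Normalized restrictions *)

Section normalized_restriction.
Context {R : realType} {d} {T : measurableType d}.
Variables (mu : {measure set T -> \bar R}) (D : set T) (w : R).
Hypotheses (mD : measurable D) (w0 : (0 < w)%R) (muD : mu D = w%:E).
Local Open Scope ereal_scope.

Let w0' : (0 <= w^-1)%R. Proof. by rewrite invr_ge0 ltW. Qed.

Let scaled : {measure set T -> \bar R} := mscale (NngNum w0') (mrestr mu mD).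

Let scaled_setT : scaled setT = 1.
Proof.
transitivity ((w^-1)%:E * mu (setT `&` D)); first by [].
by rewrite setTI muD -EFinM mulVf// gt_eqF.
Qed.

(** The measure [dx_j / omega_j] of a piece, extended by zero to the whole space so that all
    coordinates share one type. *)
Definition normalized_restr : probability T R :=
  HB.pack (Measure.sort scaled)
    (Measure_isProbability.Build _ _ _ (Measure.sort scaled) scaled_setT).

Lemma ge0_integral_normalized_restr (h : T -> \bar R) :
  measurable_fun setT h -> (forall y, 0 <= h y) ->
  \int[normalized_restr]_y h y = (w^-1)%:E * \int[mu]_(y in D) h y.
Proof.
move=> mh h0; rewrite ge0_integral_mscale//=; congr (_ * _).
have mDC : measurable (~` D) by exact: measurableC.
rewrite [LHS](ge0_negligible_integral mDC)//; last first.
  by rewrite -[RHS](measure0 mu) -(setICl D).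
rewrite setTD setCK; apply: eq_measure_integral => A mA AD.
by transitivity (mu (A `&` D)); rewrite // setIidl.
Qed.

Lemma integrable_normalized_restr (h : T -> \bar R) :
  mu.-integrable setT h -> normalized_restr.-integrable setT h.
Proof.
move=> /[dup] ih /integrableP[mh hoo]; apply/integrableP; split => //.
have mabs : measurable_fun setT (fun x => `|h x|) by exact: measurableT_comp.
rewrite ge0_integral_normalized_restr//.
apply: lte_mul_pinfty => //; rewrite ?lee_fin//.
apply: le_lt_trans hoo; apply: ge0_subset_integral => //.
Qed.

Lemma integral_normalized_restr (h : T -> \bar R) : mu.-integrable setT h ->
  \int[normalized_restr]_y h y = (w^-1)%:E * \int[mu]_(y in D) h y.
Proof.
move=> ih; have mh : measurable_fun setT h by case/integrableP : ih.
have ihD : mu.-integrable D h by exact: integrableS ih.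
rewrite [LHS]integralE [X in _ = _ * X]integralE.
rewrite ge0_integral_normalized_restr//; last exact: measurable_funepos.
rewrite ge0_integral_normalized_restr//; last exact: measurable_funeneg.
move: (integrable_add_def mD ihD).
move: (\int[mu]_(x in D) h^\+ x) (\int[mu]_(x in D) h^\- x) => a b ab.
by rewrite muleBr.
Qed.

End normalized_restriction.

(** * The Marcinkiewicz-Zygmund inequality on a product *)

Section MZ_constants.
Context {R : realType}.

(* Tested on a single centred Bernoulli variable. *)
Lemma MZ_upper_ge1 (r B : R) : 1 <= r -> MZ_upper_ok r B -> 1 <= B.
Proof.
move=> r1 okB; have r0 : 0 < r by rewrite (lt_le_trans ltr01).
have h01 : 0 <= (2^-1 : R) <= 1 by lra.
pose f (j : 'I_1) (b : bool) : R := b%:R.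
have mf j : measurable_fun setT (f j) by [].
have int_f j : Rintegral (bernoulli_prob 2^-1) setT (f j) = 2^-1.
  rewrite /Rintegral integral_bernoulli_prob//=.
    by rewrite /f/= /unstable.onem; field.
  by move=> x; rewrite lee_fin.
have fam : MZ_family (bernoulli_prob (2^-1 : R)) r f.
  split=> //.
    move=> j; rewrite Lnorm_finE integral_bernoulli_prob//; last first.
      by move=> x; exact: poweR_ge0.
    by apply: poweR_lty; rewrite -!EFinM ltry.
  move=> C mC; rewrite big_ord1; congr (fine (_ _)).
  apply/seteqP; split=> [b /= h|b /= h j _]; first exact: h.
  by rewrite (ord1 j).
have lhsE : MZ_rhs (bernoulli_prob (2^-1 : R)) r f =
    MZ_lhs (bernoulli_prob (2^-1 : R)) r f.
  rewrite /MZ_rhs /MZ_lhs -[RHS]Lnorm_abse; apply: eq_Lnorm => b /=.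
  by rewrite !big_ord1 sqrtr_sqr.
have lhs_gt0 : (0 < MZ_lhs (bernoulli_prob (2^-1 : R)) r f)%E.
  rewrite /MZ_lhs Lnorm_finE integral_bernoulli_prob//; last first.
    by move=> x; exact: poweR_ge0.
  apply: poweR_gt0; rewrite !big_ord1 !int_f.
  have -> : f ord0 true - 2^-1 = 2^-1 by rewrite /f /=; lra.
  have -> : f ord0 false - 2^-1 = - 2^-1 by rewrite /f /=; lra.
  rewrite /= normrN -!EFinM -EFinD lte_fin.
  have h : 0 < `|2^-1 : R| `^ r by apply: powR_gt0; rewrite normr_gt0 invr_neq0.
  by rewrite addr_gt0// mulr_gt0// /unstable.onem; lra.
have lhs_fin : (MZ_lhs (bernoulli_prob (2^-1 : R)) r f < +oo)%E.
  rewrite /MZ_lhs Lnorm_finE integral_bernoulli_prob//; last first.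
    by move=> x; exact: poweR_ge0.
  by apply: poweR_lty; rewrite -!EFinM ltry.
have := okB _ _ _ _ _ fam; rewrite lhsE.
move: lhs_gt0 lhs_fin; case: (MZ_lhs _ _ _) => // v; rewrite lte_fin => v0 _.
by rewrite -EFinM lee_fin -{1}[v]mul1r ler_pM2r.
Qed.

End MZ_constants.

Section MZ_product.
Context {R : realType} {d} {T : measurableType d} {N : nat}.
Variables (Q : 'I_N -> probability T R) (g : 'I_N -> T -> R) (r : R).
Hypothesis r1 : 1 <= r.
Hypothesis ig : forall j, (Q j).-integrable setT (EFin \o g j).
Hypothesis g0 : forall j, (\int[Q j]_y (g j y)%:E = 0)%E.
Local Notation O := (@prodT d T N).
Local Notation P := (productP Q).
Local Open Scope ereal_scope.

Let mg j : measurable_fun setT (g j).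
Proof. by apply/measurable_EFinP; case/integrableP : (ig j). Qed.

Let mgx j : measurable_fun setT (fun x : O => g j (x j)).
Proof. exact: (measurableT_comp (mg j) (measurable_coordinate j)). Qed.

Let r0 : (0 < r)%R. Proof. by rewrite (lt_le_trans ltr01). Qed.

Let centered_integral j : Rintegral P setT (fun x => g j (x j)) = 0%R.
Proof.
rewrite /Rintegral integralE.
have tr (h : T -> \bar R) : measurable_fun setT h -> (forall y, 0 <= h y) ->
    \int[P]_x h (x j) = \int[Q j]_y h y.
  by move=> mh h0; exact: ge0_integral_productP_marginal.
have mEg : measurable_fun setT (EFin \o g j) by exact/measurable_EFinP.
transitivity (fine
    (\int[Q j]_y (EFin \o g j)^\+ y - \int[Q j]_y (EFin \o g j)^\- y)).
  congr (fine (_ - _)).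
    rewrite -(tr (EFin \o g j)^\+)//; last exact: measurable_funepos.
    by apply: eq_integral => x _; rewrite !funeposE.
  rewrite -(tr (EFin \o g j)^\-)//; last exact: measurable_funeneg.
  by apply: eq_integral => x _; rewrite !funenegE.
by rewrite -integralE g0.
Qed.

Let sum_centered x : (\sum_(j < N) (g j (x j) -
  Rintegral P setT (fun x => g j (x j))))%R = (\sum_(j < N) g j (x j))%R.
Proof. by apply: eq_bigr => j _; rewrite centered_integral subr0. Qed.

Let Lnorm_marginal j :
  'N[P]_r%:E[(fun x => (g j (x j))%:E)] = 'N[Q j]_r%:E[(EFin \o g j)].
Proof.
apply: (@Lnorm_transfer _ _ _ P _ _ (Q j) (fun x => x j) r%:E (EFin \o g j)).
- by move=> F mF F0; exact: ge0_integral_productP_marginal.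
- exact: measurable_coordinate.
- by rewrite lee_fin.
- by rewrite [ltRHS]probability_setT.
- by rewrite [ltRHS]probability_setT.
- exact/measurable_EFinP.
Qed.

Let family_fin : (forall j, 'N[Q j]_r%:E[(EFin \o g j)] < +oo) ->
  MZ_family P r (fun j x => g j (x j)).
Proof.
move=> gfin; split=> //; last exact: productP_indep.
by move=> j; rewrite Lnorm_marginal.
Qed.

Let msum : measurable_fun setT (fun x : O => (\sum_(j < N) g j (x j))%R).
Proof. exact: measurable_sum. Qed.

Let square_function (x : O) := Num.sqrt (\sum_(j < N) g j (x j) ^+ 2)%R.

Let msquare : measurable_fun setT square_function.
Proof.
rewrite /square_function.
apply: (measurableT_comp (continuous_measurable_fun (@sqrt_continuous R))).
by apply: measurable_sum => j; exact: measurable_funX.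
Qed.

Let MZ_lhsE : MZ_lhs P r (fun j x => g j (x j)) =
  'N[P]_r%:E[(fun x => (\sum_(j < N) g j (x j))%:E)].
Proof. by rewrite /MZ_lhs; apply: eq_Lnorm => x; rewrite sum_centered. Qed.

Let MZ_rhsE : MZ_rhs P r (fun j x => g j (x j)) =
  'N[P]_r%:E[(EFin \o square_function)].
Proof.
rewrite /MZ_rhs; apply: eq_Lnorm => x /=; congr (Num.sqrt _)%:E.
by apply: eq_bigr => j _; rewrite centered_integral subr0.
Qed.

(** The square function dominates each [|g i|]. *)
Let Lnorm_square_infty i : 'N[Q i]_r%:E[(EFin \o g i)] = +oo ->
  'N[P]_r%:E[(EFin \o square_function)] = +oo.
Proof.
move=> gi; apply/eqP; rewrite -leye_eq -gi -Lnorm_marginal.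
apply: ae_le_Lnorm; rewrite ?lee_fin//.
- exact/measurable_EFinP.
- exact/measurable_EFinP.
apply: nearW => x /=; rewrite lee_fin [leRHS]ger0_norm ?sqrtr_ge0//.
rewrite -sqrtr_sqr ler_sqrt; last by apply: sumr_ge0 => j _; exact: sqr_ge0.
by rewrite (bigD1 i)//= lerDl sumr_ge0// => j _; exact: sqr_ge0.
Qed.

(* If the norm of the sum were finite, freezing all coordinates but the i-th at
   a generic point would put a translate of [g i] in L^r. *)
Let Lnorm_sum_infty i : 'N[Q i]_r%:E[(EFin \o g i)] = +oo ->
  'N[P]_r%:E[(fun x => (\sum_(j < N) g j (x j))%:E)] = +oo.
Proof.
move=> gi; apply/eqP; rewrite -leye_eq leNgt; apply/negP => sum_fin.
pose F (x : O) := `|(\sum_(j < N) g j (x j))%:E| `^ r.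
have mF : measurable_fun setT F by apply: measurable_abse_poweR; exact/measurable_EFinP.
have F0 x : 0 <= F x by exact: poweR_ge0.
have : \int[P]_x F x < +oo.
  rewrite -/F -poweR_Lnorm; last by rewrite gt_eqF.
  exact: poweR_lty.
rewrite (@ge0_integral_prodP_resample _ _ _ _ _ i)//; last by rewrite mem_enum.
move=> Ffin; pose G (x : O) := \int[Q i]_z F (upd x i z).
have G0 x : 0 <= G x by exact: integral_ge0.
have iG : P.-integrable setT G.
  apply/integrableP; split.
    apply: (@measurable_fun_fubini_tonelli_G _ _ _ _ _ (Q i)
      (fun z : T * O => F (upd z.2 i z.1))) => //.
    exact: (measurableT_comp mF (measurable_upd _)).
  by under eq_integral do rewrite gee0_abs//.
have [x Gx] : exists x, G x < +oo.
  have := integrable_ae measurableT iG; move=> aeG; apply: contrapT => /forallNP nG.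
  have : P setT = 0.
    apply/eqP; rewrite eq_le measure_ge0 andbT.
    case: aeG => A [mA A0 GA]; rewrite -A0; apply: le_measure; rewrite ?inE//.
    move=> x _; apply: GA => /= /(_ Logic.I).
    by rewrite ge0_fin_numE//; exact: nG.
  by rewrite probability_setT => /eqP; rewrite onee_eq0.
pose c := (\sum_(j < N | j != i) g j (x j))%R.
have : 'N[Q i]_r%:E[(EFin \o (g i \+ cst c)%R)] < +oo.
  rewrite Lnorm_finE; apply: poweR_lty; move: Gx; congr (_ < _).
  apply: eq_integral => z _; rewrite /F/= (bigD1 i)//= /upd eqxx /c.
  by congr (`|_ + _|%R `^ r)%:E; apply: eq_bigr => j /negbTE ->.
move=> trans_fin; suff : 'N[Q i]_r%:E[(EFin \o g i)] < +oo by rewrite gi.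
have mc : measurable_fun [set: T] (cst c) by [].
apply: le_lt_trans (lerB_DLnorm (Q i) (mg i) mc r1) _.
apply: lte_add_pinfty => //.
rewrite Lnorm_finE; apply: poweR_lty.
rewrite (eq_integral (fun=> `|c|%:E `^ r))// integral_prob_cst.
by apply: poweR_lty; rewrite ltry.
Qed.

(** The [g j] are only integrable, while [MZ_family] demands finite norms. If some norm is infinite,
    the right-hand side is [+oo], because [1 <= B] excludes a zero factor. *)
Lemma MZ_upper_product (B : R) : MZ_upper_ok r B ->
  'N[P]_r%:E[(fun x => (\sum_(j < N) g j (x j))%:E)] <=
  B%:E * 'N[P]_r%:E[(fun x => (Num.sqrt (\sum_(j < N) g j (x j) ^+ 2))%:E)].
Proof.
move=> okB; have [gfin|/existsNP[i]] :=
    pselect (forall j, 'N[Q j]_r%:E[(EFin \o g j)] < +oo).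
  by rewrite -MZ_lhsE -MZ_rhsE; apply: okB; exact: family_fin.
move=> /negP; rewrite -leNgt leye_eq => /eqP gi.
rewrite [X in _ <= _ * X](Lnorm_square_infty gi) gt0_muley ?leey//.
by rewrite lte_fin (lt_le_trans ltr01)//; exact: MZ_upper_ge1 okB.
Qed.

(** Here an infinite norm of some [g i] is absorbed by the sum, whose norm is then [+oo]. *)
Lemma MZ_lower_product (A : R) : MZ_lower_ok r A ->
  A%:E * 'N[P]_r%:E[(fun x => (Num.sqrt (\sum_(j < N) g j (x j) ^+ 2))%:E)] <=
  'N[P]_r%:E[(fun x => (\sum_(j < N) g j (x j))%:E)].
Proof.
move=> okA; have [gfin|/existsNP[i]] :=
    pselect (forall j, 'N[Q j]_r%:E[(EFin \o g j)] < +oo).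
  by rewrite -MZ_lhsE -MZ_rhsE; apply: okA; exact: family_fin.
move=> /negP; rewrite -leNgt leye_eq => /eqP gi.
by rewrite (Lnorm_sum_infty gi) leey.
Qed.

End MZ_product.

(** * Finiteness almost everywhere, homogeneity and Hölder's inequality *)

Section Lnorm_more.
Context {R : realType} {d} {S : measurableType d}.
Variable nu : {measure set S -> \bar R}.
Local Open Scope ereal_scope.

Lemma Lnorm_fin_ae (q : \bar R) (f : S -> \bar R) : 1 <= q -> 0 < nu setT ->
  measurable_fun setT f -> 'N[nu]_q[f] < +oo ->
  {ae nu, forall x, `|f x| < +oo}.
Proof.
case: q => // [r|] q1 nu0 mf.
  have r0 : (r != 0)%R by rewrite gt_eqF// (lt_le_trans ltr01).
  rewrite Lnorm_finE => /lty_poweRy -/(_ _)/wrap[|fin]; first by rewrite invr_eq0.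
  have : nu.-integrable setT (fun x => `|f x| `^ r).
    apply/integrableP; split; first exact: measurable_abse_poweR.
    by under eq_integral do rewrite gee0_abs ?poweR_ge0//.
  move=> /(integrable_ae measurableT); apply: filterS => x /(_ Logic.I).
  by rewrite ge0_fin_numE ?poweR_ge0//; exact: lty_poweRy.
rewrite Lnorm_infE// => fin.
by apply: filterS (ess_sup_ge nu (abse \o f)) => x /le_lt_trans; exact.
Qed.

Lemma Lnorm_scale (r k : R) (f : S -> \bar R) : (1 <= r)%R -> (0 <= k)%R ->
  measurable_fun setT f -> (forall x, 0 <= f x) ->
  'N[nu]_r%:E[(fun x => k%:E * f x)] = k%:E * 'N[nu]_r%:E[f].
Proof.
move=> r1 k0 mf f0; have r0 : (r != 0)%R by rewrite gt_eqF// (lt_le_trans ltr01).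
rewrite !Lnorm_finE.
under eq_integral do rewrite abseM poweRM ?abse_ge0//.
rewrite ge0_integralZl//.
- rewrite poweRM ?poweR_ge0//; last first.
    by apply: integral_ge0 => x _; exact: poweR_ge0.
  by rewrite -poweRrM mulfV// poweRe1 ?gee0_abs ?lee_fin// normr_ge0.
- exact: measurable_abse_poweR.
- by move=> x _; exact: poweR_ge0.
- exact: poweR_ge0.
Qed.

Let hoelder_infty (f g : S -> R) : 0 < nu setT ->
  measurable_fun setT f -> measurable_fun setT g ->
  \int[nu]_x `|(f x * g x)%:E| <=
    'N[nu]_+oo[(EFin \o f)] * 'N[nu]_1[(EFin \o g)].
Proof.
move=> nu0 mf mg; rewrite Lnorm1 -ge0_integralZl//; last 2 first.
- by apply: measurableT_comp => //; exact/measurable_EFinP.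
- exact: Lnorm_ge0.
apply: ae_ge0_le_integral => //.
- by apply: measurableT_comp => //; apply/measurable_EFinP; exact: measurable_funM.
- by move=> x _; rewrite mule_ge0// Lnorm_ge0.
- by apply: measurable_funeM; apply: measurableT_comp => //; exact/measurable_EFinP.
rewrite Lnorm_infE//.
apply: filterS (ess_sup_ge nu (abse \o (EFin \o f))) => x fx _.
by rewrite EFinM abseM; apply: lee_wpmul2r.
Qed.

Lemma hoelder_conj (p q : \bar R) (f g : S -> R) : conj_exp p q -> 0 < nu setT ->
  measurable_fun setT f -> measurable_fun setT g ->
  \int[nu]_x `|(f x * g x)%:E| <=
    'N[nu]_q[(EFin \o f)] * 'N[nu]_p[(EFin \o g)].
Proof.
move=> [[-> ->]|[[-> ->]|[r [s [-> -> r1 s1 rs]]]]] nu0 mf mg.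
- exact: hoelder_infty.
- rewrite muleC; under eq_integral do rewrite mulrC; exact: hoelder_infty.
- have := @hoelder _ _ _ nu f g s r mf mg; rewrite Lnorm1; apply.
  + by rewrite (lt_trans ltr01).
  + by rewrite (lt_trans ltr01).
  + by rewrite addrC.
Qed.

End Lnorm_more.

Section conj_exp.
Context {R : realType}.
Implicit Types p q : \bar R.

Lemma conj_exp_ge1r p q : conj_exp p q -> (1 <= q)%E.
Proof.
move=> [[_ ->]|[[_ ->]//|[r [s [_ -> _ s1 _]]]]]; first exact: leey.
by rewrite lee_fin ltW.
Qed.

Lemma conj_exp_finr p q : conj_exp p q -> (1 < p)%E -> q = (fine q)%:E.
Proof.
by move=> [[-> _]|[[_ ->]//|[r [s [_ -> _ s1 _]]]]]; rewrite ?ltxx.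
Qed.

End conj_exp.

Section iterated_more.
Context {R : realType} {d1 d2} {S : measurableType d1} {T : measurableType d2}.
Variable mu : {sigma_finite_measure set T -> \bar R}.
Local Open Scope ereal_scope.

(** With [Lnorm_iterated_fin], this puts the norm over the nodes inside, at fixed [y], which is
    where the Marcinkiewicz-Zygmund inequality applies. *)
Lemma Lnorm_iterated_swap_fin (P : probability S R) (W : S * T -> R) (r : R) :
  measurable_fun setT W -> (1 <= r)%R ->
  'N[mu]_r%:E[(fun y => 'N[P]_r%:E[(fun x => (W (x, y))%:E)])] =
  'N[(P \x mu)]_r%:E[EFin \o W].
Proof.
move=> mW r1; have r0 : r != 0%R by rewrite gt_eqF// (lt_le_trans ltr01).
rewrite !Lnorm_finE; congr (_ `^ _).
rewrite fubini_tonelli2; last 2 first.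
- by apply: measurable_abse_poweR; exact/measurable_EFinP.
- by move=> z; exact: poweR_ge0.
apply: eq_integral => x _; rewrite gee0_abs ?Lnorm_ge0// Lnorm_finE.
by rewrite -poweRrM mulVf// poweRe1// integral_ge0// => y _; exact: poweR_ge0.
Qed.

Lemma measurable_Lnorm_section_swap_fin (P : probability S R) (W : S * T -> R)
    (r : R) : measurable_fun setT W ->
  measurable_fun setT (fun y => 'N[P]_r%:E[(fun x => (W (x, y))%:E)]).
Proof.
move=> mW; under eq_fun do rewrite Lnorm_finE.
apply: (@measurableT_comp _ _ _ _ _ _ _ _ _ (measurable_poweR r^-1)).
apply: (@measurable_fun_fubini_tonelli_G _ _ _ _ _ P
  (fun z => `|(W z)%:E| `^ r)) => //.
- by apply: measurable_abse_poweR; exact/measurable_EFinP.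
- by move=> z; exact: poweR_ge0.
Qed.

(** The kernel is integrable in its first variable only for almost every second one, so divergent
    sections must be covered: the integral is [fine] of a difference of two Tonelli integrals, both
    measurable. *)
Lemma measurable_Rintegral (D : set T) (H : S * T -> R) : measurable D ->
  measurable_fun setT H ->
  measurable_fun setT (fun s => Rintegral mu D (fun z => H (s, z))).
Proof.
move=> mD mH; under eq_fun do rewrite Rintegral_mkcond.
pose H' (z : S * T) := (\1_D z.2 * H z)%R.
have mH' : measurable_fun setT H'.
  apply: measurable_funM => //.
  by apply: (@measurableT_comp _ _ _ _ _ _ (\1_D : T -> R)); [exact: measurable_indic|].
rewrite (_ : (fun s => _) = fun s => fine (\int[mu]_z (H' (s, z))%:E)); last first.
  apply/funext => s; congr fine; apply: eq_integral => z _; congr EFin.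
  by rewrite /H' /patch indicE/=; case: ifPn => _; rewrite ?mul1r ?mul0r.
apply: (measurableT_comp (fine_measurable measurableT)).
have mEH' : measurable_fun setT (EFin \o H') by exact/measurable_EFinP.
rewrite (_ : (fun s => _) = (fun s =>
    \int[mu]_z (EFin \o H')^\+ (s, z) - \int[mu]_z (EFin \o H')^\- (s, z))).
  apply: emeasurable_funB.
    apply: (measurable_fun_fubini_tonelli_F (m2 := mu)) => //.
    exact: measurable_funepos.
  apply: (measurable_fun_fubini_tonelli_F (m2 := mu)) => //.
  exact: measurable_funeneg.
apply/funext => s; rewrite integralE; congr (_ - _).
  by apply: eq_integral => z _; rewrite !funeposE.
by apply: eq_integral => z _; rewrite !funenegE.
Qed.

Lemma Rintegral_partition (N : nat) (X : 'I_N -> set T) (f : T -> R) :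
  (forall j, measurable (X j)) -> trivIset setT X -> \bigcup_j X j = setT ->
  mu.-integrable setT (EFin \o f) ->
  (\sum_(j < N) Rintegral mu (X j) f)%R = Rintegral mu setT f.
Proof.
move=> mX tX UX fi.
have UX' : \big[setU/set0]_(j <- enum 'I_N) X j = setT.
  rewrite -UX -bigcup_seq; apply/seteqP; split=> [x [j _ Xj]|x [j _ Xj]]; exists j => //.
  by rewrite /= mem_enum.
have fiX j : mu.-integrable (X j) (EFin \o f) by exact: integrableS fi.
apply: EFin_inj; rewrite -sumEFin [RHS]fineK; last exact: integrable_fin_num.
rewrite -UX' integral_bigsetU_EFin ?enum_uniq//=.
- rewrite big_enum/=; apply: eq_bigr => j _.
  rewrite fineK//.
  exact: (integrable_fin_num (mX j) (fiX j)).
- exact: sub_trivIset tX.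
- by rewrite UX'; case/integrableP : fi.
Qed.

End iterated_more.

(** * The error functional and its kernel *)

Section pairing.
Context {R : realType} {d} {T : measurableType d}.
Variable mu : {finite_measure set T -> \bar R}.
Variables p q : \bar R.
Hypothesis hpq : conj_exp p q.
Hypothesis mu0 : (0 < mu setT)%E.

Lemma hoelder_integrable (f g : T -> R) :
  measurable_fun setT f -> measurable_fun setT g ->
  (Lnorm mu q (EFin \o f) < +oo)%E -> (Lnorm mu p (EFin \o g) < +oo)%E ->
  mu.-integrable setT (fun y => (f y * g y)%:E).
Proof.
move=> mf mg ff gf; apply/integrableP; split.
  by apply/measurable_EFinP; exact: measurable_funM.
apply: le_lt_trans (hoelder_conj hpq mu0 mf mg) _.
apply: lte_mul_pinfty => //; first exact: Lnorm_ge0.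
by rewrite ge0_fin_numE// Lnorm_ge0.
Qed.

Lemma Rintegral_sum (I : Type) (s : seq I) (f : I -> T -> R) :
  (forall i, mu.-integrable setT (EFin \o f i)) ->
  Rintegral mu setT (fun y => \sum_(i <- s) f i y) =
  \sum_(i <- s) Rintegral mu setT (f i).
Proof.
move=> fi; rewrite /Rintegral sum_fine; last first.
  by move=> i _; exact: (integrable_fin_num measurableT (fi i)).
by congr fine; under eq_integral do rewrite -sumEFin; rewrite integral_sum.
Qed.

Variable Phi : T -> T -> R.
Hypothesis hPhim : measurable_fun setT (fun z : T * T => Phi z.1 z.2).
Hypothesis hPhi1 : forall x, (Lnorm mu q (fun y => (Phi x y)%:E) < +oo)%E.
Hypothesis hPhi2 : (Lnorm mu q (fun y => (\int[mu]_x `|Phi x y|%:E)%E) < +oo)%E.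

Let q1 : (1 <= q)%E. Proof. exact: conj_exp_ge1r hpq. Qed.

Lemma measurable_kernel1 x : measurable_fun setT (Phi x).
Proof. exact: (measurableT_comp hPhim (measurable_pair1 x)). Qed.

Lemma measurable_kernel2 y : measurable_fun setT (fun x => Phi x y).
Proof. exact: (measurableT_comp hPhim (measurable_pair2 y)). Qed.

(** The kernel representing the integral of a potential. Where [Phi ^~ y] is not integrable it takes
    the default value 0; by [ae_integrable_kernel] such [y] form a negligible set. *)
Definition kernel_mean y : R := Rintegral mu setT (fun x => Phi x y).

Lemma measurable_kernel_mean : measurable_fun setT kernel_mean.
Proof.
apply: (@measurable_Rintegral _ _ _ _ _ mu setT (fun z => Phi z.2 z.1)) => //.
have mswap : measurable_fun setT (fun z : T * T => (z.2, z.1)).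
  exact: measurable_fun_pair.
exact: (measurableT_comp hPhim mswap).
Qed.

Let H y := (\int[mu]_x `|Phi x y|%:E)%E.
(** Real-valued version of [H], as Hölder's inequality is stated for real functions; [ae_h] shows
    that the two agree almost everywhere. *)
Let h y := fine (H y).

Let mH : measurable_fun setT H.
Proof.
apply: (@measurable_fun_fubini_tonelli_G _ _ _ _ _ mu
  (fun z => `|Phi z.1 z.2|%:E)%E) => //.
by apply/measurable_EFinP; exact: measurableT_comp.
Qed.

Let mh : measurable_fun setT h.
Proof. exact: (measurableT_comp (fine_measurable measurableT)). Qed.

Let H0 y : (0 <= H y)%E. Proof. by apply: integral_ge0 => x _; rewrite lee_fin. Qed.

Lemma ae_integrable_kernel :
  {ae mu, forall y, mu.-integrable setT (fun x => (Phi x y)%:E)}.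
Proof.
apply: filterS (Lnorm_fin_ae q1 mu0 mH hPhi2) => y Hy.
apply/integrableP; split; first exact/measurable_EFinP/measurable_kernel2.
by move: Hy; rewrite gee0_abs// H0.
Qed.

Let ae_h : {ae mu, forall y, H y = (h y)%:E}.
Proof.
apply: filterS (Lnorm_fin_ae q1 mu0 mH hPhi2) => y.
by rewrite gee0_abs// => Hy; rewrite /h fineK// ge0_fin_numE.
Qed.

Let h_fin : (Lnorm mu q (EFin \o h) < +oo)%E.
Proof.
apply: le_lt_trans hPhi2; apply: ae_le_Lnorm => //; first exact/measurable_EFinP.
apply: filterS ae_h => y Hy.
by have -> : (EFin \o h) y = H y by rewrite Hy.
Qed.

Lemma Lnorm_kernel_mean_fin : (Lnorm mu q (EFin \o kernel_mean) < +oo)%E.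
Proof.
apply: le_lt_trans h_fin; apply: ae_le_Lnorm => //.
- exact/measurable_EFinP/measurable_kernel_mean.
- exact/measurable_EFinP.
apply: filterS ae_integrable_kernel => y iy /=.
rewrite lee_fin [leRHS]ger0_norm ?fine_ge0//.
exact: le_normr_Rintegral.
Qed.

(** Fubini's theorem for [Phi x y * g y]. Integrating its modulus first in [x] leaves [h * |g|],
    integrable by Hölder's inequality and [hPhi2]; [hPhi1] makes [f x] a convergent integral at
    every [x]. *)
Lemma Rintegral_potential (f g : T -> R) : inLp mu p g -> represents mu Phi f g ->
  Rintegral mu setT f = Rintegral mu setT (fun y => kernel_mean y * g y).
Proof.
move=> [mg gfin] fg.
have mG : measurable_fun setT (fun z : T * T => (Phi z.1 z.2 * g z.2)%:E).
  apply/measurable_EFinP; apply: measurable_funM => //.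
  exact: (measurableT_comp mg measurable_snd).
have iG : (mu \x mu)%E.-integrable setT (fun z : T * T => (Phi z.1 z.2 * g z.2)%:E).
  apply/integrable21ltyP => //.
  have /integrableP[_] := hoelder_integrable mh mg h_fin gfin.
  apply: le_lt_trans; apply: ae_ge0_le_integral => //.
  - by move=> y _; exact: integral_ge0.
  - apply: (@measurable_fun_fubini_tonelli_G _ _ _ _ _ mu
      (fun z => `|(Phi z.1 z.2 * g z.2)%:E|)%E) => //.
    exact: measurableT_comp.
  - by apply: measurableT_comp => //; apply/measurable_EFinP; exact: measurable_funM.
  apply: filterS ae_h => y Hy _.
  rewrite (eq_integral (fun x => `|Phi x y|%:E * `|(g y)%:E|)%E); last first.
    by move=> x _; rewrite EFinM abseM.
  rewrite ge0_integralZr//.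
  - by rewrite EFinM abseM -Hy (gee0_abs (H0 y)) lexx.
  - by apply/measurable_EFinP; apply: measurableT_comp => //; exact: measurable_kernel2.
congr fine; transitivity (\int[mu]_x \int[mu]_y (Phi x y * g y)%:E)%E.
  apply: eq_integral => x _; rewrite fg fineK//.
  apply: integrable_fin_num => //; apply: hoelder_integrable => //.
    exact: measurable_kernel1.
  exact: hPhi1.
transitivity (\int[mu]_y \int[mu]_x (Phi x y * g y)%:E)%E.
  exact: (Fubini iG).
apply: ae_eq_integral => //.
- exact: (measurable_fubini_G iG).
- apply/measurable_EFinP; apply: measurable_funM => //.
  exact: measurable_kernel_mean.
apply: filterS ae_integrable_kernel => y iy _.
rewrite (eq_integral (fun x => (Phi x y)%:E * (g y)%:E)%E)//.
by rewrite integralZr// EFinM /kernel_mean /Rintegral fineK// integrable_fin_num.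
Qed.

Variables (N : nat) (omega : 'I_N -> R) (x : 'I_N -> T).

(** Written with the full mean rather than with the terms [inner]: the two expressions are only
    shown to agree at those [y] where [Phi ^~ y] is integrable. *)
Definition error_kernel y := \sum_(j < N) omega j * Phi (x j) y - kernel_mean y.

Let mPhi j : measurable_fun setT (fun y => omega j * Phi (x j) y).
Proof. by apply: measurable_funM => //; exact: measurable_kernel1. Qed.

Lemma measurable_error_kernel : measurable_fun setT error_kernel.
Proof.
apply: measurable_funB; last exact: measurable_kernel_mean.
exact: measurable_sum.
Qed.

Lemma Lnorm_error_kernel_fin : (Lnorm mu q (EFin \o error_kernel) < +oo)%E.
Proof.
have [L0 LD] := Lfun_submod_closed mu q1.
have inL (f : T -> R) : measurable_fun setT f ->
    (Lnorm mu q (EFin \o f) < +oo)%E -> f \in Lfun mu q.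
  by move=> mf ff; rewrite inE; apply/andP; split; rewrite inE.
have sumL (s : seq 'I_N) : \sum_(j <- s) (omega j *: Phi (x j)) \in Lfun mu q.
  elim: s => [|j s IH]; first by rewrite big_nil.
  rewrite big_cons; apply: LD IH; apply: inL; last exact: hPhi1.
  exact: measurable_kernel1.
have -> : error_kernel =
    -1 *: kernel_mean + \sum_(j < N) (omega j *: Phi (x j)).
  apply/funext => y; rewrite /error_kernel addrC.
  by rewrite scaleN1r /= [RHS]/GRing.add/= fct_sumE.
have /andP[_] : -1 *: kernel_mean + \sum_(j < N) (omega j *: Phi (x j)) \in Lfun mu q.
  apply: LD (sumL _); apply: inL; first exact: measurable_kernel_mean.
  exact: Lnorm_kernel_mean_fin.
by rewrite inE.
Qed.

Lemma Err_pairing (f g : T -> R) : inLp mu p g -> represents mu Phi f g ->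
  Err mu omega x f = Rintegral mu setT (fun y => error_kernel y * g y).
Proof.
move=> hg fg; have [mg gfin] := hg.
have iPhi j : mu.-integrable setT (fun y => (Phi (x j) y * g y)%:E).
  by apply: hoelder_integrable => //; [exact: measurable_kernel1|exact: hPhi1].
have iPhi' j : mu.-integrable setT (EFin \o (fun y => omega j * (Phi (x j) y * g y))).
  exact: (integrableZl measurableT (omega j) (iPhi j)).
have iK : mu.-integrable setT (fun y => (kernel_mean y * g y)%:E).
  apply: hoelder_integrable => //; first exact: measurable_kernel_mean.
  exact: Lnorm_kernel_mean_fin.
transitivity (Rintegral mu setT (fun y =>
    \sum_(j < N) omega j * (Phi (x j) y * g y) - kernel_mean y * g y)).
  rewrite RintegralB//; last first.
    rewrite (_ : EFin \o _ =
        (fun y => \sum_(j < N) (omega j * (Phi (x j) y * g y))%:E)%E).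
      by apply: integrable_sum => // j _; exact: iPhi'.
    by apply/funext => y /=; rewrite sumEFin.
  rewrite /Err (Rintegral_potential hg fg) Rintegral_sum//; congr (_ - _).
  by apply: eq_bigr => j _; rewrite fg -RintegralZl//; exact: iPhi.
apply: eq_Rintegral => y _; rewrite /error_kernel mulrBl; congr (_ - _).
by rewrite mulr_suml; apply: eq_bigr => j _; rewrite mulrA.
Qed.

(** Hölder's inequality holds for every [g] representing [f], while the left-hand side depends on
    [f] alone; the infimum over [g] gives the norm of [f]. *)
Lemma Err_le (f : T -> R) : inH mu p Phi f ->
  (`|Err mu omega x f|%:E <= Lnorm mu q (EFin \o error_kernel) * Hnorm mu p Phi f)%E.
Proof.
move=> [g0 [hg0 fg0]].
have bound g : inLp mu p g -> represents mu Phi f g ->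
    (`|Err mu omega x f|%:E <=
      Lnorm mu q (EFin \o error_kernel) * Lnorm mu p (fun y => (g y)%:E))%E.
  move=> hg fg; rewrite (Err_pairing hg fg); have [mg gfin] := hg.
  apply: le_trans (hoelder_conj hpq mu0 measurable_error_kernel mg).
  rewrite EFin_normr_Rintegral//; last first.
    by apply: hoelder_integrable => //;
      [exact: measurable_error_kernel|exact: Lnorm_error_kernel_fin].
  apply: le_abse_integral => //; apply/measurable_EFinP.
  by apply: measurable_funM => //; exact: measurable_error_kernel.
have := Lnorm_ge0 mu q (EFin \o error_kernel).
(* Passing to the infimum divides by this factor, so its vanishing is treated apart. *)
rewrite le_eqVlt => /predU1P[E0|E0].
  by move: (bound g0 hg0 fg0); rewrite -E0 !mul0e.
have Efin : Lnorm mu q (EFin \o error_kernel) \is a fin_num.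
  by rewrite ge0_fin_numE ?Lnorm_ge0//; exact: Lnorm_error_kernel_fin.
have Epos : 0 < fine (Lnorm mu q (EFin \o error_kernel)).
  by apply: fine_gt0; rewrite E0; exact: Lnorm_error_kernel_fin.
rewrite muleC -(fineK Efin) -lee_pdivrMr//.
apply: le_ereal_inf_tmp => _ [g [hg fg] <-].
by rewrite lee_pdivrMr// fineK// muleC bound.
Qed.

Lemma Err_norm_le :
  (Err_norm mu omega p Phi x <= Lnorm mu q (EFin \o error_kernel))%E.
Proof.
apply: ge_ereal_sup => _ [->|[f [Hf Hf0] <-]]; first exact: Lnorm_ge0.
have Hge0 : (0 <= Hnorm mu p Phi f)%E.
  by apply: le_ereal_inf_tmp => _ [g _ <-]; exact: Lnorm_ge0.
have Hfin : (Hnorm mu p Phi f < +oo)%E.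
  have [g hg] := Hf; apply: le_lt_trans hg.1.2.
  by apply: ereal_inf_lbound; exists g.
have Hpos : (0 < Hnorm mu p Phi f)%E by rewrite lt_neqAle Hge0 andbT eq_sym.
rewrite EFinM lee_pdivrMr ?fine_gt0 ?Hpos// fineK ?ge0_fin_numE//.
exact: Err_le.
Qed.

End pairing.

(** * Duality and extremal functions *)

Section duality.
Context {R : realType} {d} {T : measurableType d}.
Variable mu : {finite_measure set T -> \bar R}.
Variables p q : \bar R.
Hypothesis hpq : conj_exp p q.
Hypothesis mu0 : (0 < mu setT)%E.
Variable Phi : T -> T -> R.
Hypothesis hPhim : measurable_fun setT (fun z : T * T => Phi z.1 z.2).
Hypothesis hPhi1 : forall x, (Lnorm mu q (fun y => (Phi x y)%:E) < +oo)%E.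
Hypothesis hPhi2 : (Lnorm mu q (fun y => (\int[mu]_x `|Phi x y|%:E)%E) < +oo)%E.

(** The equality case of Hölder's inequality: its product with [K] is [|K|] to the power [r]. For
    [r = 1] it is the sign of [K]. *)
Definition extremal (r : R) (K : T -> R) y := Num.sg (K y) * `|K y| `^ (r - 1).

Lemma measurable_extremal (r : R) (K : T -> R) :
  measurable_fun setT K -> measurable_fun setT (extremal r K).
Proof.
move=> mK; apply: measurable_funM.
  apply: (@measurableT_comp _ _ _ _ _ _ (@Num.sg R)) => //.
  apply: nondecreasing_measurable => // a b ab.
  by case: (sgrP a) => ha; case: (sgrP b) => hb; rewrite ?ler01 ?lerN10 ?lexx//;
    exfalso; lra.
apply: (measurableT_comp (measurable_powR (r - 1))).
exact: measurableT_comp.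
Qed.

Lemma mulr_extremal (r : R) (K : T -> R) y : 1 <= r ->
  K y * extremal r K y = `|K y| `^ r.
Proof.
move=> r1; rewrite /extremal mulrA [K y * _]mulrC -normrEsg.
by rewrite mulr_powRB1// (lt_le_trans ltr01).
Qed.

Lemma normr_extremal_le (r : R) (K : T -> R) y :
  `|extremal r K y| <= `|K y| `^ (r - 1).
Proof.
rewrite /extremal normrM (ger0_norm (powR_ge0 _ _)) normr_sg.
by case: eqP => _; rewrite ?mul1r// mul0r powR_ge0.
Qed.

(** For finite [p], conjugacy reads [(r - 1) * p = r], so the [p]-th power of the extremal function
    is at most [|K|] to the power [r]. For [p = +oo] and [r = 1], the function is bounded by 1 and
    the right-hand side is a zeroth power, hence 1. *)
Lemma Lnorm_extremal_le (r : R) (K : T -> R) : q = r%:E ->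
  measurable_fun setT K ->
  (Lnorm mu p (EFin \o extremal r K) <= Lnorm mu q (EFin \o K) `^ (r - 1))%E.
Proof.
move=> qr mK; move: hpq; rewrite qr.
move=> [[_ ]//|[[-> [->]]|[p' [r' [-> [<-] p1 r1 pr]]]]].
  rewrite subrr poweRe0 Lnorm_infE//; apply/ess_supP/nearW => y /=.
  rewrite lee_fin; apply: le_trans (normr_extremal_le 1 K y) _.
  by rewrite subrr powRr0.
have p0 : p' != 0 by rewrite gt_eqF// (lt_trans ltr01).
have r0 : r != 0 by rewrite gt_eqF// (lt_trans ltr01).
have rp : (r - 1) * p' = r.
  have : p'^-1 = 1 - r^-1 by rewrite -pr addrK.
  move=> /(congr1 (fun t => t * p' * r)); rewrite mulVf// mul1r => E.
  rewrite [RHS]E [RHS]mulrAC; congr (_ * _).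
  by rewrite [RHS]mulrBl mul1r mulVf.
have rp1 : r^-1 * (r - 1) = p'^-1.
  have s0 : r - 1 != 0 by rewrite subr_eq0 gt_eqF.
  have -> : r^-1 = (r - 1)^-1 * p'^-1 by rewrite -invfM rp.
  by rewrite mulrAC mulVf// mul1r.
rewrite !Lnorm_finE -poweRrM rp1.
apply: gt0_ler_poweR; rewrite ?invr_ge0 ?(ltW (lt_trans ltr01 p1))//.
- by rewrite in_itv/= leey andbT integral_ge0// => y _; exact: poweR_ge0.
- by rewrite in_itv/= leey andbT integral_ge0// => y _; exact: poweR_ge0.
apply: ge0_le_integral => //.
- by move=> y _; exact: poweR_ge0.
- by apply: measurable_abse_poweR; apply/measurable_EFinP; exact: measurable_extremal.
- by apply: measurable_abse_poweR; exact/measurable_EFinP.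
move=> y _ /=; rewrite lee_fin -{2}rp powRrM.
apply: ge0_ler_powR; rewrite ?nnegrE ?powR_ge0 ?normr_extremal_le//.
by rewrite (ltW (lt_trans ltr01 p1)).
Qed.

Variables (N : nat) (omega : 'I_N -> R) (x : 'I_N -> T).
Local Notation K := (error_kernel mu Phi omega x).

(** Let [a] be the norm of [K]. The potential of the extremal function has error [a ^ r] and norm at
    most [a ^ (r - 1)], so its quotient is at least [a]. *)
Lemma Err_norm_ge (r : R) : q = r%:E ->
  (Lnorm mu q (EFin \o K) <= Err_norm mu omega p Phi x)%E.
Proof.
move=> qr; have r1 : 1 <= r by rewrite -lee_fin -qr; exact: conj_exp_ge1r hpq.
have r0 : 0 < r by rewrite (lt_le_trans ltr01).
have mK : measurable_fun setT K by exact: measurable_error_kernel.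
have Kfin : (Lnorm mu q (EFin \o K) < +oo)%E.
  exact: (Lnorm_error_kernel_fin hpq).
have := Lnorm_ge0 mu q (EFin \o K); rewrite le_eqVlt => /predU1P[<-|K0].
  by apply: ereal_sup_ubound; left.
have KE : Lnorm mu q (EFin \o K) = (fine (Lnorm mu q (EFin \o K)))%:E.
  by rewrite fineK// ge0_fin_numE// ltW.
pose a := fine (Lnorm mu q (EFin \o K)).
have a0 : 0 < a by apply: fine_gt0; rewrite K0 Kfin.
pose g := extremal r K.
have mg : measurable_fun setT g by exact: measurable_extremal.
have gle : (Lnorm mu p (EFin \o g) <= (a `^ (r - 1))%:E)%E.
  by rewrite -poweR_EFin -KE; exact: Lnorm_extremal_le.
have gLp : inLp mu p g by split=> //; apply: le_lt_trans gle _; rewrite ltry.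
pose f z := Rintegral mu setT (fun y => Phi z y * g y).
have fH : inH mu p Phi f by exists g.
have ErrE : Err mu omega x f = a `^ r.
  rewrite (Err_pairing hpq mu0 hPhim hPhi1 hPhi2 omega x gLp (fun=> erefl)).
  apply: EFin_inj; rewrite -poweR_EFin -KE qr poweR_Lnorm ?gt_eqF//.
  have intE : (\int[mu]_y (K y * g y)%:E = \int[mu]_y (`|(EFin \o K) y| `^ r))%E.
    by apply: eq_integral => y _; rewrite mulr_extremal.
  rewrite /Rintegral intE fineK// -poweR_Lnorm ?gt_eqF// -qr KE poweR_EFin//.
have Hle : (Hnorm mu p Phi f <= (a `^ (r - 1))%:E)%E.
  by apply: le_trans gle; apply: ereal_inf_lbound; exists g.
have Hge0 : (0 <= Hnorm mu p Phi f)%E.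
  by apply: le_ereal_inf_tmp => _ [? _ <-]; exact: Lnorm_ge0.
(* The supremum in [Err_norm] ranges over potentials of nonzero norm; zero norm would force zero
   error by [Err_le]. *)
have Hneq0 : Hnorm mu p Phi f != 0%E.
  apply/eqP => H0; have := Err_le hpq mu0 hPhim hPhi1 hPhi2 omega x fH.
  rewrite H0 mule0 ErrE lee_fin normr_le0 => /eqP/eqP.
  by rewrite gt_eqF// powR_gt0.
have HE : Hnorm mu p Phi f = (fine (Hnorm mu p Phi f))%:E.
  by rewrite fineK// ge0_fin_numE//; apply: le_lt_trans Hle _; rewrite ltry.
have Hpos : 0 < fine (Hnorm mu p Phi f).
  by rewrite -lte_fin -HE lt_neqAle Hge0 andbT eq_sym.
apply: le_ereal_sup_tmp.
exists (`|Err mu omega x f| / fine (Hnorm mu p Phi f))%:E.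
  by right; exists f.
rewrite KE lee_fin ler_pdivlMr// ErrE ger0_norm ?powR_ge0//.
apply: (@le_trans _ _ (a * a `^ (r - 1))).
  by rewrite ler_pM2l// -lee_fin -HE.
by rewrite mulr_powRB1// ltW.
Qed.

End duality.

(** * Passage to the best constants *)

Section best_constants.
Context {R : realType}.
Local Open Scope ereal_scope.

(** When [D = +oo], division is impossible, but a single positive element of [S] already forces
    [c = +oo]. *)
Lemma ereal_sup_mulr_le (S : set R) (D c : \bar R) : 0 <= D -> 0 <= c -> S 0%R ->
  (forall a, S a -> a%:E * D <= c) -> ereal_sup [set a%:E | a in S] * D <= c.
Proof.
move=> D0 c0 S0 Sle; set s := ereal_sup _.
have s0 : 0 <= s by apply: ereal_sup_ubound; exists 0%R.
move: D0; rewrite le_eqVlt => /predU1P[<-|D0]; first by rewrite mule0.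
have [->|sN0] := eqVneq s 0; first by rewrite mul0e.
have [a Sa a0] : exists2 a, S a & (0 < a)%R.
  apply: contrapT => nS; move: sN0; rewrite eq_le s0 andbT => /negP; apply.
  apply: ge_ereal_sup => _ [a Sa <-]; rewrite lee_fin leNgt.
  by apply/negP => a0; apply: nS; exists a.
case: D D0 Sle => // [D|] D0 Sle.
  rewrite -lee_pdivlMr//; apply: ge_ereal_sup => _ [b Sb <-].
  by rewrite lee_pdivlMr// Sle.
by have := Sle _ Sa; rewrite gt0_muley// leye_eq => /eqP ->; rewrite leey.
Qed.

(** [S] may be empty, with infimum [+oo], and [+oo * 0 = 0]: hence the separate assumption for
    [D = 0]. The lower bound 1 keeps the product infinite when [D = +oo]. *)
Lemma ereal_inf_mulr_ge (S : set R) (D c : \bar R) : 0 <= D ->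
  (D = 0 -> c = 0) -> (forall b, S b -> (1 <= b)%R) ->
  (forall b, S b -> c <= b%:E * D) -> c <= ereal_inf [set b%:E | b in S] * D.
Proof.
move=> D0 Dc S1 Sle; set s := ereal_inf _.
have s1 : 1 <= s by apply: le_ereal_inf_tmp => _ [b Sb <-]; rewrite lee_fin S1.
move: D0; rewrite le_eqVlt => /predU1P[D0|D0].
  by rewrite -D0 mule0 Dc.
case: D D0 Sle {Dc} => // [D|] D0 Sle.
  rewrite -lee_pdivrMr//; apply: le_ereal_inf_tmp => _ [b Sb <-].
  by rewrite lee_pdivrMr// Sle.
by rewrite gt0_muley ?leey// (lt_le_trans lte01).
Qed.

Lemma MZ_lower0 (r : R) : MZ_lower_ok r 0.
Proof. by move=> d O P n f _; rewrite mul0e Lnorm_ge0. Qed.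

End best_constants.

(** * Points where a function is at most its mean *)

Section below_the_mean.
Context {R : realType} {d} {S : measurableType d} (P : probability S R).
Local Open Scope ereal_scope.

Lemma ae_prob_exists (B C : set S) : measurable B -> P B = 1 ->
  {ae P, forall x, C x} -> exists2 x, B x & C x.
Proof.
move=> mB PB [A [mA A0 CA]]; apply: contrapT => nBC.
have : P B <= P A.
  apply: le_measure; rewrite ?inE// => x Bx; apply: CA => Cx.
  by apply: nBC; exists x.
by rewrite PB A0 leNgt lte01.
Qed.

(** Otherwise [f - k] would be positive almost surely with a nonpositive integral. *)
Lemma exists_le_integral (B : set S) (f : S -> \bar R) (k : R) :
  measurable B -> P B = 1 -> measurable_fun setT f -> (forall x, 0 <= f x) ->
  (0 <= k)%R -> \int[P]_x f x <= k%:E -> exists2 x, B x & f x <= k%:E.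
Proof.
move=> mB PB mf f0 k0 fk; apply: contrapT => nB.
have Bf x : B x -> k%:E < f x.
  by move=> Bx; rewrite ltNge; apply/negP => fx; apply: nB; exists x.
have aeB : {ae P, forall x, B x}.
  exists (~` B); split => //; first exact: measurableC.
  by rewrite probability_setC// PB subee.
(* The positive part is nonnegative everywhere, so additivity holds with no integrability of [f]; it
   equals [f - k] on [B]. *)
pose u := (fun x => f x - k%:E)^\+%E.
have mu_ : measurable_fun setT u.
  by apply: measurable_funepos; apply: emeasurable_funB.
have u0 x : 0 <= u x by exact: funepos_ge0.
have uE x : B x -> u x = f x - k%:E.
  move=> Bx; rewrite /u funeposE; apply/max_idPl.
  by rewrite sube_ge0 ?orbT// ltW// Bf.
have fE : \int[P]_x f x = \int[P]_x u x + k%:E.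
  rewrite -[X in _ + X](integral_prob_cst P) -ge0_integralD//.
  apply: ge0_ae_eq_integral => //.
  - exact: emeasurable_funD.
  - by move=> x _; apply: adde_ge0; [exact: funepos_ge0|rewrite lee_fin].
  by apply: filterS aeB => x Bx _; rewrite uE// subeK.
have iu0 : \int[P]_x `|u x| = 0.
  under eq_integral do rewrite gee0_abs//.
  apply/eqP; rewrite eq_le integral_ge0// andbT.
  by move: fk; rewrite fE -[leRHS]add0e leeD2rE.
have /(ae_eq_integral_abs P measurableT mu_) aeu := iu0.
have [x Bx /(_ Logic.I)] := ae_prob_exists mB PB aeu.
by rewrite uE// => /eqP; rewrite gt_eqF// sube_gt0 Bf.
Qed.

(** For finite [q] the previous lemma applies to the powers of [h] and [c]; for [q = +oo] almost
    every point qualifies. The set [B] of full measure will force each node into its piece. *)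
Lemma exists_le_Lnorm (B : set S) (q : \bar R) (h : S -> \bar R) (c : \bar R) :
  measurable B -> P B = 1 -> 1 <= q -> measurable_fun setT h ->
  (forall x, 0 <= h x) -> 'N[P]_q[h] <= c -> exists2 x, B x & h x <= c.
Proof.
move=> mB PB q1 mh h0 hc.
have c0 : 0 <= c by rewrite (le_trans _ hc)// Lnorm_ge0.
case: q q1 hc => // [r|] q1 hc; last first.
  move: hc; rewrite Lnorm_infE ?[ltRHS]probability_setT// => hc.
  apply: ae_prob_exists => //.
  apply: filterS (ess_sup_ge P (abse \o h)) => x /= hx.
  by apply: le_trans hc; rewrite -{1}(gee0_abs (h0 x)).
have r0 : (0 < r)%R by rewrite (lt_le_trans ltr01).
case: c c0 hc => // [c|] c0 hc; last first.
  have [x Bx _] := @ae_prob_exists B setT mB PB (aeW _ (fun=> Logic.I)).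
  by exists x => //; rewrite leey.
have mp : measurable_fun setT (fun x => `|h x| `^ r) by exact: measurable_abse_poweR.
have := @exists_le_integral B _ (c `^ r)%R mB PB mp _ _ _.
case.
- by move=> x; exact: poweR_ge0.
- exact: powR_ge0.
- rewrite -poweR_Lnorm ?gt_eqF// -poweR_EFin.
  by apply: gt0_ler_poweR; rewrite ?in_itv/= ?leey ?Lnorm_ge0 ?c0// ltW.
move=> x Bx; rewrite gee0_abs// => hx; exists x => //.
have rinv : (0 <= r^-1)%R by rewrite invr_ge0 ltW.
have /(_ (h x `^ r) (c `^ r)%:E) := @gt0_ler_poweR R r^-1 rinv.
rewrite !in_itv/= !leey !poweR_ge0 lee_fin powR_ge0 => /(_ isT isT hx).
by rewrite -poweRrM -powRrM mulfV ?gt_eqF// poweRe1// powRr1.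
Qed.

End below_the_mean.

(** * Averages over the nodes *)

Section average_error.
Context {R : realType} {d} {T : measurableType d}.
Variables (mu : {finite_measure set T -> \bar R}) (N : nat).
Variables (X : 'I_N -> set T) (omega : 'I_N -> R).
Hypothesis hXm : forall j, measurable (X j).
Hypothesis hXdisj : trivIset setT X.
Hypothesis hXcov : \bigcup_j X j = setT.
Hypothesis hXmu : forall j, mu (X j) = (omega j)%:E.
Hypothesis homega : forall j, 0 < omega j.
Variables p q : \bar R.
Hypothesis hpq : conj_exp p q.
Variable Phi : T -> T -> R.
Hypothesis hPhim : measurable_fun setT (fun z : T * T => Phi z.1 z.2).
Hypothesis hPhi1 : forall x, (Lnorm mu q (fun y => (Phi x y)%:E) < +oo)%E.
Hypothesis hPhi2 : (Lnorm mu q (fun y => (\int[mu]_x `|Phi x y|%:E)%E) < +oo)%E.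

Local Notation O := (@prodT d T N).
Local Notation inner := (inner mu X Phi).
Local Open Scope ereal_scope.

Let Q j : probability T R := normalized_restr (hXm j) (homega j) (hXmu j).
Let P : probability O R := productP Q.

Let q1 : 1 <= q. Proof. exact: conj_exp_ge1r hpq. Qed.

(** [T] contains [point], so at least one piece exists, and it has positive mass. *)
Let mu0 : 0 < mu setT.
Proof.
have : (\bigcup_j X j) point by rewrite hXcov.
move=> [j _ _]; apply: (@lt_le_trans _ _ (mu (X j))); first by rewrite hXmu lte_fin.
by apply: le_measure; rewrite ?inE.
Qed.

Let prod_gt0 {d'} {S : measurableType d'} (P' : probability S R) :
  0 < (P' \x mu) setT.
Proof. by rewrite product_prob_setT. Qed.

Let QE j (h : T -> \bar R) : measurable_fun setT h -> (forall y, 0 <= h y) ->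
  \int[Q j]_y h y = ((omega j)^-1)%:E * \int[mu]_(y in X j) h y.
Proof. exact: ge0_integral_normalized_restr. Qed.

Let prodintE (F : O -> \bar R) : measurable_fun setT F -> (forall x, 0 <= F x) ->
  prodint mu X omega F = \int[P]_x F x.
Proof.
by move=> mF F0; rewrite /P /productP (ge0_integral_prodPE QE)// enum_uniq.
Qed.

Lemma measurable_inner j : measurable_fun setT (fun z : T * T => inner j z.1 z.2).
Proof.
apply: (@measurable_Rintegral _ _ _ _ _ mu (X j)
  (fun z : (T * T) * T => Phi z.1.1 z.1.2 - Phi z.2 z.1.2)%R) => //.
apply: measurable_funB.
- exact: (measurableT_comp hPhim measurable_fst).
- have m : measurable_fun setT (fun z : (T * T) * T => (z.2, z.1.2)).
    apply: measurable_fun_pair => //.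
    exact: (measurableT_comp measurable_snd measurable_fst).
  exact: (measurableT_comp hPhim m).
Qed.

Let at_coordinate j (z : O * T) : T * T := (z.1 j, z.2).

Let measurable_at_coordinate j : measurable_fun setT (at_coordinate j).
Proof.
apply: measurable_fun_pair => //.
exact: (measurableT_comp (measurable_coordinate j) measurable_fst).
Qed.

Let minner j : measurable_fun setT (fun z : O * T => inner j (z.1 j) z.2).
Proof. exact: (measurableT_comp (measurable_inner j) (measurable_at_coordinate j)). Qed.

Let W (z : O * T) : R := (\sum_(j < N) inner j (z.1 j) z.2)%R.
Let V (z : O * T) : R := Num.sqrt (\sum_(j < N) inner j (z.1 j) z.2 ^+ 2)%R.

Let mW : measurable_fun setT W. Proof. exact: measurable_sum. Qed.

Let mV : measurable_fun setT V.
Proof.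
apply: (measurableT_comp (continuous_measurable_fun (@sqrt_continuous R))).
by apply: measurable_sum => j; exact: measurable_funX.
Qed.

Let innerE y j xj : mu.-integrable setT (fun x => (Phi x y)%:E) ->
  inner j xj y =
  (omega j * Phi xj y - Rintegral mu (X j) (fun z => Phi z y))%R.
Proof.
move=> iy; rewrite /Defs.inner RintegralB//.
- rewrite Rintegral_cst// mulrC; congr (_ * _ - _)%R.
  exact: (congr1 fine (hXmu j)).
- exact: finite_measure_integrable_cst.
- exact: integrableS iy.
Qed.

Let W_error_kernel y (x : O) : mu.-integrable setT (fun x => (Phi x y)%:E) ->
  W (x, y) = error_kernel mu Phi omega x y.
Proof.
move=> iy; rewrite /W /error_kernel /kernel_mean.
under eq_bigr do rewrite innerE//.
by rewrite sumrB (Rintegral_partition hXm hXdisj hXcov).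
Qed.

Let integrable_inner y j : mu.-integrable setT (fun x => (Phi x y)%:E) ->
  (Q j).-integrable setT (EFin \o inner j ^~ y).
Proof.
move=> iy; apply: integrable_normalized_restr.
rewrite (_ : _ \o _ = (fun xj => (omega j)%:E * (Phi xj y)%:E -
    (Rintegral mu (X j) (fun z => Phi z y))%:E)); last first.
  by apply/funext => xj /=; rewrite innerE// EFinB EFinM.
apply: integrableB => //; first exact: integrableZl.
exact: finite_measure_integrable_cst.
Qed.

(** The mean over a piece of [omega j * Phi xj y] is the integral of [Phi ^~ y] over that piece,
    which is the constant subtracted in [innerE]. *)
Let integral_inner y j : mu.-integrable setT (fun x => (Phi x y)%:E) ->
  \int[Q j]_xj (inner j xj y)%:E = 0.
Proof.
move=> iy; have iyX : mu.-integrable (X j) (fun x => (Phi x y)%:E).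
  exact: integrableS iy.
have -> : \int[Q j]_xj (inner j xj y)%:E =
    \int[Q j]_xj ((omega j)%:E * (Phi xj y)%:E -
      (Rintegral mu (X j) (fun z => Phi z y))%:E).
  by apply: eq_integral => xj _; rewrite innerE// EFinB EFinM.
rewrite integralB//; last 2 first.
- by apply: integrableZl => //; exact: integrable_normalized_restr.
- exact: finite_measure_integrable_cst.
rewrite integral_prob_cst integralZl//; last exact: integrable_normalized_restr.
rewrite integral_normalized_restr// muleA -EFinM divff ?gt_eqF// mul1e.
by rewrite /Rintegral fineK ?subee// ?integrable_fin_num.
Qed.

Let ae_good := ae_integrable_kernel hpq mu0 hPhim hPhi2.

(** Measurable majorant of [Err_norm], equal to it for finite [q]; every upper bound is proved for
    it. *)
Let A x := 'N[mu]_q[(fun y => (W (x, y))%:E)].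

Let mA : measurable_fun setT A. Proof. exact: measurable_Lnorm_section. Qed.

Let A_error_kernel x : A x = 'N[mu]_q[(EFin \o error_kernel mu Phi omega x)].
Proof.
apply: ae_eq_Lnorm => //.
- by apply/measurable_EFinP; exact: (measurableT_comp mW (measurable_pair1 x)).
- by apply/measurable_EFinP; exact: measurable_error_kernel.
by apply: filterS ae_good => y iy /=; rewrite W_error_kernel.
Qed.

Let GammaE : Gamma mu X omega q Phi =
  \sum_(j < N) 'N[(Q j \x mu)]_q[(fun z => (inner j z.1 z.2)%:E)].
Proof.
apply: eq_bigr => j _; rewrite -[RHS]Lnorm_abse.
rewrite (@LqI_Lnorm _ _ _ (Q j \x mu))//.
- move=> F mF F0; rewrite fubini_tonelli1// QE//.
    exact: measurable_fun_fubini_tonelli_F.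
  by move=> y; exact: integral_ge0.
- exact: prod_gt0.
- by apply/measurable_EFinP; apply: measurableT_comp => //; exact: measurable_inner.
Qed.

Let DeltaE : Delta mu X omega q Phi = 'N[(P \x mu)]_q[(EFin \o V)].
Proof.
apply: LqI_Lnorm => //.
- move=> F mF F0; rewrite fubini_tonelli1//; apply: prodintE.
    exact: measurable_fun_fubini_tonelli_F.
  by move=> x; exact: integral_ge0.
- exact: prod_gt0.
- exact/measurable_EFinP.
- by move=> z; rewrite lee_fin sqrtr_ge0.
Qed.

Let prodint_mono (f g : O -> \bar R) : (forall x, 0 <= f x) ->
  (forall x, f x <= g x) -> prodint mu X omega f <= prodint mu X omega g.
Proof.
move=> f0 fg; rewrite /prodint; elim: (enum 'I_N) (fun=> point) => //= j s IH x.
apply: lee_wpmul2l; first by rewrite lee_fin invr_ge0 ltW.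
by apply: ge0_le_integral_nomeas => y _ //; exact: iint_ge0.
Qed.

Let LqI_A : LqI (prodint mu X omega) q A = 'N[P]_q[A].
Proof.
apply: LqI_Lnorm => //; first by rewrite [ltRHS]probability_setT.
by move=> x; exact: Lnorm_ge0.
Qed.

(** Valid also for [q = +oo], by comparison under the iterated integral itself, where [Err_norm]
    need not be measurable. *)
Let avg_err_le : avg_err mu X omega p q Phi <= 'N[P]_q[A].
Proof.
rewrite -LqI_A; apply: le_LqI => //.
- by move=> f f0; exact: iint_ge0.
- by rewrite (lt_le_trans _ q1).
- by move=> x; apply: ereal_sup_ubound; left.
- by move=> x; rewrite A_error_kernel; exact: Err_norm_le.
Qed.

Let avg_errE (r : R) : q = r%:E -> avg_err mu X omega p q Phi = 'N[P]_q[A].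
Proof.
move=> qr; rewrite -LqI_A; congr LqI; apply/funext => x; apply/eqP.
rewrite eq_le A_error_kernel.
by rewrite Err_norm_le//= (Err_norm_ge hpq _ _ _ _ _ _ qr).
Qed.

(** Minkowski's inequality is used on the product of [P] and [mu]. Each summand depends on one node
    only, so its norm reduces to the marginal [Q j]. *)
Let A_le_Gamma : 'N[P]_q[A] <= Gamma mu X omega q Phi.
Proof.
apply: le_trans (Lnorm_iterated_le P mW q1 mu0) _; rewrite GammaE.
apply: le_trans (Lnorm_sum _ _ q1 minner) _; apply: lee_sum => j _.
have := @Lnorm_transfer _ _ _ (P \x mu) _ _ (Q j \x mu) (at_coordinate j) q
  (fun z => (inner j z.1 z.2)%:E).
move=> -> //; last 3 first.
- exact: prod_gt0.
- exact: prod_gt0.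
- by apply/measurable_EFinP; exact: measurable_inner.
move=> F mF F0; rewrite !fubini_tonelli1//; last first.
  exact: (measurableT_comp mF (measurable_at_coordinate j)).
rewrite -(ge0_integral_productP_marginal Q j (h := fun x => \int[mu]_y F (x, y)))//.
- exact: measurable_fun_fubini_tonelli_F.
- by move=> x; exact: integral_ge0.
Qed.

Let LnormW (r : R) : q = r%:E -> 'N[P]_q[A] =
  'N[mu]_r%:E[(fun y => 'N[P]_r%:E[(fun x => (W (x, y))%:E)])].
Proof.
move=> qr; have r1 : (1 <= r)%R by rewrite -lee_fin -qr.
by rewrite Lnorm_iterated_swap_fin// -Lnorm_iterated_fin// /A qr.
Qed.

Let DeltaV (r : R) : q = r%:E -> Delta mu X omega q Phi =
  'N[mu]_r%:E[(fun y => 'N[P]_r%:E[(fun x => (V (x, y))%:E)])].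
Proof.
move=> qr; have r1 : (1 <= r)%R by rewrite -lee_fin -qr.
by rewrite Lnorm_iterated_swap_fin// DeltaE qr.
Qed.

Let A_le_MZ (r B : R) : q = r%:E -> MZ_upper_ok r B ->
  'N[P]_q[A] <= B%:E * Delta mu X omega q Phi.
Proof.
move=> qr okB; have r1 : (1 <= r)%R by rewrite -lee_fin -qr.
have B0 : (0 <= B)%R by rewrite (le_trans ler01)//; exact: MZ_upper_ge1 okB.
have mWr := measurable_Lnorm_section_swap_fin P r mW.
have mVr := measurable_Lnorm_section_swap_fin P r mV.
rewrite (LnormW qr) (DeltaV qr) -Lnorm_scale//; last first.
  by move=> y; exact: Lnorm_ge0.
apply: ae_le_Lnorm => //; first exact: measurable_funeM.
apply: filterS ae_good => y iy.
rewrite !gee0_abs ?mule_ge0 ?Lnorm_ge0//.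
apply: (MZ_upper_product (Q := Q) (g := fun j xj => inner j xj y) r1) => //.
- by move=> j; exact: integrable_inner.
- by move=> j; exact: integral_inner.
Qed.

Let MZ_le_A (r a : R) : q = r%:E -> MZ_lower_ok r a ->
  a%:E * Delta mu X omega q Phi <= 'N[P]_q[A].
Proof.
move=> qr oka; have r1 : (1 <= r)%R by rewrite -lee_fin -qr.
(* A nonpositive constant cannot be moved inside the norm, but then the bound is a matter of
   signs. *)
have [a0|a0] := leP a 0%R.
  apply: (@le_trans _ _ 0); last exact: Lnorm_ge0.
  by rewrite DeltaE; apply: mule_le0_ge0; [rewrite lee_fin|exact: Lnorm_ge0].
have mWr := measurable_Lnorm_section_swap_fin P r mW.
have mVr := measurable_Lnorm_section_swap_fin P r mV.
rewrite (LnormW qr) (DeltaV qr) -Lnorm_scale ?(ltW a0)//; last first.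
  by move=> y; exact: Lnorm_ge0.
apply: ae_le_Lnorm => //; first exact: measurable_funeM.
apply: filterS ae_good => y iy.
rewrite !gee0_abs ?mule_ge0 ?Lnorm_ge0 ?lee_fin ?(ltW a0)//.
apply: (MZ_lower_product (Q := Q) (g := fun j xj => inner j xj y) r1) => //.
- by move=> j; exact: integrable_inner.
- by move=> j; exact: integral_inner.
Qed.

(** Covers the case where [MZ_B] could be [+oo] and its product with [Delta] still 0: a vanishing
    square function kills every [inner] term, hence [W]. *)
Let Delta0_A (r : R) : q = r%:E -> Delta mu X omega q Phi = 0 -> 'N[P]_q[A] = 0.
Proof.
move=> qr; rewrite DeltaE => V0.
have q0 : 0 < q by rewrite (lt_le_trans _ q1).
have mEV : measurable_fun setT (EFin \o V) by exact/measurable_EFinP.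
have aeV := Lnorm_eq0_eq0 mEV q0 V0.
apply/eqP; rewrite eq_le Lnorm_ge0 andbT.
apply: le_trans (Lnorm_iterated_le P mW q1 mu0) _.
rewrite -(Lnorm0 (P \x mu) (p := q)) ?gt_eqF//.
apply: ae_le_Lnorm => //; first exact/measurable_EFinP.
apply: filterS aeV => z /= /(_ Logic.I) [] /eqP.
rewrite sqrtr_eq0 => Vz; suff -> : W z = 0%R by [].
rewrite /W big1// => j _; apply/eqP; rewrite -sqrf_eq0 eq_le sqr_ge0 andbT.
apply: le_trans Vz; rewrite (bigD1 j)//= lerDl sumr_ge0// => i _.
exact: sqr_ge0.
Qed.

Let A_le_MZ_B (r : R) : q = r%:E ->
  'N[P]_q[A] <= MZ_B r * Delta mu X omega q Phi.
Proof.
move=> qr; have r1 : (1 <= r)%R by rewrite -lee_fin -qr.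
apply: ereal_inf_mulr_ge.
- by rewrite DeltaE Lnorm_ge0.
- exact: (Delta0_A qr).
- by move=> b; exact: MZ_upper_ge1.
- by move=> b; exact: (A_le_MZ qr).
Qed.

Let MZ_A_le_A (r : R) : q = r%:E ->
  MZ_A r * Delta mu X omega q Phi <= 'N[P]_q[A].
Proof.
move=> qr; apply: ereal_sup_mulr_le.
- by rewrite DeltaE Lnorm_ge0.
- exact: Lnorm_ge0.
- exact: MZ_lower0.
- by move=> a; exact: (MZ_le_A qr).
Qed.

(** Nodes are selected by means of [A] rather than [Err_norm], so that [Err_le] also covers
    potentials of zero norm. *)
Let exists_nodes (c : \bar R) : 'N[P]_q[A] <= c ->
  exists x : 'I_N -> T, (forall j, X j (x j)) /\
    forall f, inH mu p Phi f -> `|Err mu omega x f|%:E <= c * Hnorm mu p Phi f.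
Proof.
move=> Ac; have mbox : measurable [set x : O | forall j, X j (x j)].
  exact: measurable_box.
(* The product probability charges only tuples with each node in its own piece. *)
have Pbox : P [set x : O | forall j, X j (x j)] = 1.
  rewrite /P [LHS]productP_box// big1// => j _.
  rewrite [LHS](_ : _ = ((omega j)^-1)%:E * mu (X j `&` X j)); last by [].
  by rewrite setIid hXmu -EFinM mulVf// gt_eqF.
have [x Xx Axc] := exists_le_Lnorm mbox Pbox q1 mA (fun=> Lnorm_ge0 _ _ _) Ac.
exists x; split=> // f fH.
apply: le_trans (Err_le hpq mu0 hPhim hPhi1 hPhi2 omega x fH) _.
rewrite -A_error_kernel; apply: lee_wpmul2r => //.
by apply: le_ereal_inf_tmp => _ [g _ <-]; exact: Lnorm_ge0.
Qed.

Lemma average_error_bounds :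
  [/\ avg_err mu X omega p q Phi <= Gamma mu X omega q Phi,
      1 < p ->
        MZ_A (fine q) * Delta mu X omega q Phi <= avg_err mu X omega p q Phi /\
        avg_err mu X omega p q Phi <= MZ_B (fine q) * Delta mu X omega q Phi,
      exists x : 'I_N -> T, (forall j, X j (x j)) /\
        forall f, inH mu p Phi f ->
          `|Err mu omega x f|%:E <= Gamma mu X omega q Phi * Hnorm mu p Phi f
    & 1 < p -> exists x : 'I_N -> T, (forall j, X j (x j)) /\
        forall f, inH mu p Phi f ->
          `|Err mu omega x f|%:E
             <= MZ_B (fine q) * Delta mu X omega q Phi * Hnorm mu p Phi f].
Proof.
split.
- exact: le_trans avg_err_le A_le_Gamma.
- move=> /(conj_exp_finr hpq) qr; rewrite (avg_errE qr).
  by split; [exact: MZ_A_le_A|exact: A_le_MZ_B].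
- exact: exists_nodes.
- by move=> /(conj_exp_finr hpq) qr; apply: exists_nodes; exact: A_le_MZ_B.
Qed.

End average_error.

(** * Finiteness of the measure and conclusion *)

Section finite_measure_of.
Context {R : realType} {d} {T : measurableType d}.
Variables (mu : {measure set T -> \bar R}) (mu_fin : fin_num_fun mu).

(* Carries the proof [mu_fin], so that it can index a canonical structure. *)
Definition finite_of (_ : fin_num_fun mu) : set T -> \bar R := mu.
HB.instance Definition _ := Measure.on (finite_of mu_fin).
HB.instance Definition _ :=
  Measure_isFinite.Build d T R (finite_of mu_fin) mu_fin.
Definition finite_measure_of : {finite_measure set T -> \bar R} := finite_of mu_fin.
End finite_measure_of.

Lemma fin_num_fun_partition {R : realType} {d} {T : measurableType d}
    (mu : {measure set T -> \bar R}) (N : nat) (X : 'I_N -> set T) :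
  (forall j, measurable (X j)) -> \bigcup_j X j = setT ->
  (forall j, (mu (X j) < +oo)%E) -> fin_num_fun mu.
Proof.
move=> mX UX Xfin; apply: lty_fin_num_fun.
have <- : \big[setU/set0]_(j <- enum 'I_N) X j = setT.
  rewrite -UX -bigcup_seq.
  by apply/seteqP; split=> x [j _ Xj]; exists j => //=; rewrite mem_enum.
elim: (enum 'I_N) => [|j s IH]; first by rewrite big_nil measure0.
rewrite big_cons; apply: (@le_lt_trans _ _
    (mu (X j) + mu (\big[setU/set0]_(i <- s) X i))%E); last exact: lte_add_pinfty.
by apply: measureU2 => //; exact: bigsetU_measurable.
Qed.

Unset Implicit Arguments.
Set Strict Implicit.
Set Printing Implicit Defensive.

Theorem theorem3 (R : realType) (d : measure_display) (T : measurableType d)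
  (mu : {measure set T -> \bar R}) (N : nat) (X : 'I_N -> set T)
  (omega : 'I_N -> R)
  (hXm : forall j, measurable (X j))
  (hXdisj : trivIset setT X)
  (hXcov : \bigcup_j X j = setT)
  (hXmu : forall j, mu (X j) = (omega j)%:E)
  (homega : forall j, 0 < omega j)
  (p q : \bar R) (hpq : conj_exp p q)
  (Phi : T -> T -> R)
  (hPhim : measurable_fun setT (fun z : T * T => Phi z.1 z.2))
  (hPhi1 : forall x, (Lnorm mu q (fun y => (Phi x y)%:E) < +oo)%E)
  (hPhi2 : (Lnorm mu q (fun y => (\int[mu]_x `|Phi x y|%:E)%E) < +oo)%E) :
  [/\ (avg_err mu X omega p q Phi <= Gamma mu X omega q Phi)%E,
      (1 < p)%E ->
        (MZ_A (fine q) * Delta mu X omega q Phi <= avg_err mu X omega p q Phi)%E /\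
        (avg_err mu X omega p q Phi <= MZ_B (fine q) * Delta mu X omega q Phi)%E,
      exists x : 'I_N -> T, (forall j, X j (x j)) /\
        forall f, inH mu p Phi f ->
          (`|Err mu omega x f|%:E <= Gamma mu X omega q Phi * Hnorm mu p Phi f)%E
    & (1 < p)%E -> exists x : 'I_N -> T, (forall j, X j (x j)) /\
        forall f, inH mu p Phi f ->
          (`|Err mu omega x f|%:E
             <= MZ_B (fine q) * Delta mu X omega q Phi * Hnorm mu p Phi f)%E].
Proof.
have Xfin j : (mu (X j) < +oo)%E by rewrite hXmu ltry.
(* Finitely many pieces of finite mass make [mu] finite; the same set function is repackaged with
   that structure, as Fubini's theorem requires, and [eq_measure] brings the result back to [mu]. *)
pose mu' := finite_measure_of (fin_num_fun_partition hXm hXcov Xfin).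
have mu'E : (mu' : {measure set T -> \bar R}) = mu by exact: eq_measure.
have := @average_error_bounds R d T mu' N X omega hXm hXdisj hXcov hXmu
  homega p q hpq Phi hPhim.
by rewrite mu'E => /(_ hPhi1 hPhi2).
Qed.
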